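(* Let $\mathfrak{s}=(\mathrm{Aff}_{\mathbb{Z}},\mathcal{T})$ be the site of affine schemes with the Zariski topology, and let $X=\mathrm{Spec}\,R$ be an affine scheme. Then the usual underlying topological space of $X$ (the prime spectrum of $R$) is canonically homeomorphic to $\underline{X}=\Lambda_X^{\mathrm{top}}$, the Stone dual of the locale $\Lambda_X$ of open subschemes of $X$. Under this homeomorphism, a point $x$ of $X$ corresponds to the element $f\in\Lambda_X^{\mathrm{top}}$ for which $\{u\in\Lambda_X\mid f^\ast(u)=\mathbf{0}\}$ is the principal prime ideal generated by $[U_x\to X]$, where $U_x$ is the complement of the closure of $x$ in $X$; and for an open subscheme $U\subset X$ with class $u=[U\to X]$, the open subset $\{f\mid f^\ast(u)=\mathbf{1}\}$ of $\underline{X}$ corresponds to $U$.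
   Context: $\mathrm{Aff}_{\mathbb{Z}}$ is the category of affine schemes, the opposite of the category of commutative rings. The Zariski topology $\mathcal{T}$ is the Grothendieck pretopology whose covering families are the jointly surjective families $\{U_i\to X\}$ of open immersions in $\mathrm{Aff}_{\mathbb{Z}}$. $\mathrm{Sh}_{\mathfrak{s}}$ is the category of sheaves of sets on $\mathfrak{s}$; objects $X$ of $\mathrm{Aff}_{\mathbb{Z}}$ are identified with the sheaves $\mathrm{Hom}(-,X)$, and more generally a scheme $U$ is identified with the sheaf $\mathrm{Hom}(-,U)$ on $\mathfrak{s}$. A principal open is a morphism of $\mathrm{Aff}_{\mathbb{Z}}$ that appears in a covering family of $\mathcal{T}$, i.e. an open immersion of affine schemes. For a family $\mathcal{S}=\{U_i\to X\}$ of principal opens (not necessarily jointly surjective), the atlas $\mathcal{U}_{\mathcal{S}}$ is the diagram consisting of all $U_i$ and all pairwise fibre products $U_{ij}=U_i\times_XU_j$ together with the canonical projections $U_{ij}\to U_i$ and $U_{ij}\to U_j$. An open immersion into $X$ (in the sense of $\mathfrak{s}$) is a sheaf of the form $U=\mathrm{colim}_{\mathrm{Sh}_{\mathfrak{s}}}\,\mathcal{U}_{\mathcal{S}}$ for such a family, together with the canonical inclusion $U\to X$. Two open immersions $U\to X$ and $V\to X$ are isomorphic if there is an isomorphism $U\simeq V$ commuting with the morphisms to $X$. An open subscheme of $X$ is an isomorphism class $[U\to X]$ of open immersions. $\Lambda_X$ is the set of open subschemes of $X$, ordered by $[V\to X]\leq[U\to X]$ if and only if there is a morphism $V\to U$ commuting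 with the morphisms to $X$; it is a locale. A locale is a complete lattice in which finite meets distribute over arbitrary joins; a morphism $f:\Lambda\to\Lambda'$ of locales is a map $f^\ast:\Lambda'\to\Lambda$ preserving bottom $\mathbf{0}$, top $\mathbf{1}$, arbitrary joins and finite meets. Let $\mathbb{1}^{\mathrm{loc}}=\{\mathbf{0},\mathbf{1}\}$ be the two-element locale. The Stone dual $\Lambda^{\mathrm{top}}$ of a locale $\Lambda$ is the set of morphisms of locales $f:\mathbb{1}^{\mathrm{loc}}\to\Lambda$ (i.e. maps $f^\ast:\Lambda\to\{\mathbf{0},\mathbf{1}\}$ preserving bottom $\mathbf{0}$, top $\mathbf{1}$, arbitrary joins and finite meets) with open subsets $\{f\mid f^\ast(u)=\mathbf{1}\}$ for $u\in\Lambda$. The principal ideal generated by $u$ is $\{v\in\Lambda\mid v\leq u\}$; it is prime if its complement is non-empty and closed under finite meets. *)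

(* Defs.v *)
From Stdlib Require List.
From HB Require Import structures.
From mathcomp Require Import all_boot all_order all_algebra.
From mathcomp Require Import all_classical topology.

Set Implicit Arguments.
Unset Strict Implicit.
Unset Printing Implicit Defensive.

Import GRing.Theory.

Local Open Scope classical_set_scope.
Local Open Scope ring_scope.

(* Commutative rings are comPzRingType, so that the zero ring (whose spectrum
   is empty) is included. *)

Lemma rmorphism_ext (A B : comPzRingType) (f g : {rmorphism A -> B}) :
  f =1 g -> f = g.
Proof.
case: f => f [[fN] [fM]]; case: g => g [[gN] [gM]] /= /funext fg.
by subst g; congr GRing.RMorphism.Pack; congr GRing.RMorphism.Class;
  [congr Algebra.isNmodMorphism.Axioms_ | congr GRing.isMonoidMorphism.Axioms_];
  exact: Prop_irrelevance.
Qed.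

Record is_prime (R : comPzRingType) (p : set R) : Prop := IsPrime {
  is_prime0 : p 0;
  is_primeD : forall x y, p x -> p y -> p (x + y);
  is_primeM : forall a x, p x -> p (a * x);
  is_prime1 : ~ p 1;
  is_prime_or : forall x y, p (x * y) -> p x \/ p y }.

Record spec (R : comPzRingType) := Spec {
  prime_mem :> R -> Prop;
  specP : is_prime prime_mem }.

HB.instance Definition _ (R : comPzRingType) := gen_eqMixin (spec R).
HB.instance Definition _ (R : comPzRingType) := gen_choiceMixin (spec R).

Definition zariski_closed (R : comPzRingType) (E : set R) : set (spec R) :=
  [set p | forall x, E x -> p x].

Definition zariski_open (R : comPzRingType) (U : set (spec R)) : Prop :=
  exists E : set R, U = ~` zariski_closed E.

Section zariski_topology.
Variable R : comPzRingType.

Lemma zariski_openT : zariski_open [set: spec R].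
Proof.
exists [set 1]; apply/seteqP; split=> // p _ /= /(_ 1 erefl).
exact: is_prime1 (specP p).
Qed.

Lemma zariski_openI (U V : set (spec R)) :
  zariski_open U -> zariski_open V -> zariski_open (U `&` V).
Proof.
move=> [E ->] [F ->].
exists [set z | exists x y, [/\ E x, F y & z = x * y]].
apply/seteqP; split=> p /=.
  move=> [nE nF] EF; apply: nE => x Ex; apply: contrapT => npx.
  apply: nF => y Fy.
  have /(is_prime_or (specP p))[//|//] : p (x * y) by apply: EF; exists x, y.
move=> nEF; split=> H; apply: nEF => z [x [y [Ex Fy ->]]].
  by rewrite mulrC; apply: (is_primeM (specP p)); exact: H.
by apply: (is_primeM (specP p)); exact: H.
Qed.

Lemma zariski_open_bigcup (I : Type) (F : I -> set (spec R)) :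
  (forall i, zariski_open (F i)) -> zariski_open (\bigcup_i F i).
Proof.
move=> oF; exists [set x | exists i E, F i = ~` zariski_closed E /\ E x].
apply/seteqP; split=> p /=.
  move=> [i _ Fip] H; have [E FE] := oF i.
  by move: (Fip); rewrite FE; apply=> x Ex; apply: H; exists i, E.
move=> H; apply: contrapT => nF; apply: H => x [i [E [FE Ex]]].
apply: contrapT => npx; apply: nF; exists i => //.
by rewrite FE /= => /(_ x Ex).
Qed.

End zariski_topology.

HB.instance Definition _ (R : comPzRingType) :=
  @isOpenTopological.Build (spec R) (@zariski_open R)
    (@zariski_openT R) (@zariski_openI R) (@zariski_open_bigcup R).

Lemma comap_prime (A B : comPzRingType) (f : {rmorphism A -> B}) (q : spec B) :
  is_prime [set x | q (f x)].
Proof.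
split=> /=; first by rewrite rmorph0; exact: is_prime0 (specP q).
- by move=> x y qx qy; rewrite rmorphD; exact: is_primeD (specP q) _ _ qx qy.
- by move=> a x qx; rewrite rmorphM; exact: is_primeM (specP q) _ _ qx.
- by rewrite rmorph1; exact: is_prime1 (specP q).
- by move=> x y; rewrite rmorphM; exact: is_prime_or (specP q) _ _.
Qed.

Definition comap (A B : comPzRingType) (f : {rmorphism A -> B}) (q : spec B) :
  spec A := Spec (comap_prime f q).

(* The fraction a / s in the localization at p, as a set of pairs
   (numerator, denominator). *)
Definition fraction_at (R : comPzRingType) (p : spec R) (a s : R) :
    set (R * R) :=
  [set x | ~ p x.2 /\ exists2 u, ~ p u & u * (a * x.2 - x.1 * s) = 0].

(* The sections over U: families of elements of the stalks that are locally a
   single fraction.  A family is extended by set0 outside U, so that sections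
   over U are equal if and only if they agree on U. *)
Definition sections (R : comPzRingType) (U : set (spec R)) :
    set (spec R -> set (R * R)) :=
  [set s | (forall p, ~ U p -> s p = set0) /\
    (forall p, U p -> exists V : set (spec R), exists a b : R,
      [/\ open V, V p, V `<=` U &
          forall q, V q -> ~ q b /\ s q = fraction_at q a b])].

(* (f^# s)(q) is the image of s(f^-1 q) under A_(f^-1 q) -> B_q. *)
Definition section_pullback (A B : comPzRingType) (f : {rmorphism A -> B})
    (s : spec A -> set (A * A)) : spec B -> set (B * B) :=
  fun q => \bigcup_(x in s (comap f q)) fraction_at q (f x.1) (f x.2).

(* Spec B -> Spec A is a homeomorphism onto an open subset (its continuity is
   automatic), and it identifies the structure sheaf of this open subset with
   that of Spec B. *)
Record affine_open_immersion (A B : comPzRingType) (f : {rmorphism A -> B}) : Prop :=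
  AffineOpenImmersion {
    aoi_injective : injective (comap f);
    aoi_open : forall U, open U -> open (comap f @` U);
    aoi_sections : forall W, open W -> W `<=` range (comap f) ->
      set_bij (sections W) (sections (comap f @^-1` W)) (section_pullback f) }.

(* The family {Spec (fam_ring S i) -> Spec R}. *)
Record open_family (R : comPzRingType) := OpenFamily {
  fam_index : Type;
  fam_ring : fam_index -> comPzRingType;
  fam_map : forall i, {rmorphism R -> fam_ring i};
  fam_open : forall i, affine_open_immersion (fam_map i) }.

Arguments fam_ring {R} o i.
Arguments fam_map {R} o i.

Definition jointly_surjective (R : comPzRingType) (S : open_family R) : Prop :=
  forall x : spec R, exists i, range (comap (fam_map S i)) x.

(* Spec P, with the projections given by p and q, is the fibre product of
   Spec B and Spec C over Spec A in the category of affine schemes. *)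
Definition is_fibre_product (A B C P : comPzRingType)
    (f : {rmorphism A -> B}) (g : {rmorphism A -> C})
    (p : {rmorphism B -> P}) (q : {rmorphism C -> P}) : Prop :=
  p \o f =1 q \o g /\
  forall (T : comPzRingType) (a : {rmorphism B -> T}) (b : {rmorphism C -> T}),
    a \o f =1 b \o g ->
    exists! c : {rmorphism P -> T}, c \o p =1 a /\ c \o q =1 b.

(* Presheaves on affine schemes, as covariant functors on rings. *)
Record presheaf := Presheaf {
  ps_obj :> comPzRingType -> Type;
  ps_map : forall A B : comPzRingType, {rmorphism A -> B} -> ps_obj A -> ps_obj B;
  ps_id : forall A (x : ps_obj A), ps_map (idfun : {rmorphism A -> A}) x = x;
  ps_comp : forall (A B C : comPzRingType) (f : {rmorphism A -> B}) (g : {rmorphism B -> C})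
    (x : ps_obj A),
    ps_map (g \o f : {rmorphism A -> C}) x = ps_map g (ps_map f x) }.

Record ps_hom (F G : presheaf) := PsHom {
  ps_fun :> forall A, F A -> G A;
  ps_natural : forall (A B : comPzRingType) (f : {rmorphism A -> B}) (x : F A),
    ps_fun (ps_map f x) = ps_map f (ps_fun x) }.

(* P ranges over all the fibre products of the i-th and j-th members of S. *)
Definition matching (R : comPzRingType) (S : open_family R) (F : presheaf)
    (x : forall i, F (fam_ring S i)) : Prop :=
  forall i j (P : comPzRingType) (p : {rmorphism fam_ring S i -> P})
    (q : {rmorphism fam_ring S j -> P}),
    is_fibre_product (fam_map S i) (fam_map S j) p q ->
    ps_map p (x i) = ps_map q (x j).

Definition is_sheaf (F : presheaf) : Prop :=
  forall (R : comPzRingType) (S : open_family R), jointly_surjective S ->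
  forall x : (forall i, F (fam_ring S i)), matching x ->
    exists! y : F R, forall i, ps_map (fam_map S i) y = x i.

(* Hom(-, Spec R) *)
Program Definition rep (R : comPzRingType) : presheaf :=
  @Presheaf (fun A => {rmorphism R -> A})
    (fun A B f x => (f \o x : {rmorphism R -> B})) _ _.
Next Obligation. by move=> R A x; apply: rmorphism_ext. Qed.
Next Obligation. by move=> R A B C f g x; apply: rmorphism_ext. Qed.

Program Definition rep_map (A B : comPzRingType) (f : {rmorphism A -> B}) :
    ps_hom (rep B) (rep A) :=
  @PsHom (rep B) (rep A) (fun T x => (x \o f : {rmorphism A -> T})) _.
Next Obligation. by move=> A B f T U g x; apply: rmorphism_ext. Qed.

Lemma comap_comp (A B C : comPzRingType) (f : {rmorphism A -> B})
    (g : {rmorphism B -> C}) (q : spec C) :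
  comap (g \o f : {rmorphism A -> C}) q = comap f (comap g q).
Proof. by congr Spec; exact: Prop_irrelevance. Qed.

Section open_rep.
Variables (R : comPzRingType) (W : set (spec R)).

Definition open_rep_obj (A : comPzRingType) : Type :=
  {x : {rmorphism R -> A} | range (comap x) `<=` W}.

Lemma open_rep_subproof (A B : comPzRingType) (f : {rmorphism A -> B})
    (x : open_rep_obj A) :
  range (comap (f \o sval x : {rmorphism R -> B})) `<=` W.
Proof.
move=> _ [q _ <-]; rewrite comap_comp; apply: (svalP x).
by exists (comap f q).
Qed.

Definition open_rep_map (A B : comPzRingType) (f : {rmorphism A -> B})
    (x : open_rep_obj A) : open_rep_obj B :=
  exist _ (f \o sval x : {rmorphism R -> B}) (@open_rep_subproof A B f x).

(* Hom(-, W) for the open subscheme W of the scheme Spec R: the morphisms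
   Spec A -> W are the morphisms Spec A -> Spec R whose image lies in W. *)
Program Definition open_rep : presheaf :=
  @Presheaf open_rep_obj open_rep_map _ _.
Next Obligation. by move=> A x; apply: eq_sig_hprop => [? ? ?|];
  [exact: Prop_irrelevance | exact: rmorphism_ext]. Qed.
Next Obligation. by move=> A B C f g x; apply: eq_sig_hprop => [? ? ?|];
  [exact: Prop_irrelevance | exact: rmorphism_ext]. Qed.

End open_rep.

Record diagram := Diagram {
  vertex : Type;
  arrow : vertex -> vertex -> Type;
  dg_obj : vertex -> presheaf;
  dg_map : forall v w, arrow v w -> ps_hom (dg_obj v) (dg_obj w) }.

Record cocone (D : diagram) (U : presheaf) := Cocone {
  leg :> forall v, ps_hom (dg_obj (d := D) v) U;
  leg_comm : forall v w (e : arrow v w) A (x : dg_obj v A),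
    leg w A (dg_map e A x) = leg v A x }.

Definition is_sheaf_colimit (D : diagram) (U : presheaf) (c : cocone D U) :
    Prop :=
  is_sheaf U /\
  forall (F : presheaf) (d : cocone D F), is_sheaf F ->
    exists! t : ps_hom U F, forall v A (x : dg_obj v A), t A (c v A x) = d v A x.

Record fibre_products (R : comPzRingType) (S : open_family R) := FibreProducts {
  fib_ring : fam_index S -> fam_index S -> comPzRingType;
  fib_fst : forall i j, {rmorphism fam_ring S i -> fib_ring i j};
  fib_snd : forall i j, {rmorphism fam_ring S j -> fib_ring i j};
  fibP : forall i j,
    is_fibre_product (fam_map S i) (fam_map S j) (fib_fst i j) (fib_snd i j) }.

Inductive atlas_arrow (I : Type) : I + I * I -> I + I * I -> Type :=
  | AtlasFst i j : atlas_arrow (inr (i, j)) (inl i)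
  | AtlasSnd i j : atlas_arrow (inr (i, j)) (inl j).

Definition atlas_obj (R : comPzRingType) (S : open_family R)
    (P : fibre_products S) (v : fam_index S + fam_index S * fam_index S) :
    presheaf :=
  match v with
  | inl i => rep (fam_ring S i)
  | inr ij => rep (fib_ring P ij.1 ij.2)
  end.

Definition atlas_map (R : comPzRingType) (S : open_family R)
    (P : fibre_products S) v w (e : atlas_arrow v w) :
    ps_hom (atlas_obj P v) (atlas_obj P w) :=
  match e with
  | AtlasFst i j => rep_map (fib_fst P i j)
  | AtlasSnd i j => rep_map (fib_snd P i j)
  end.

Definition atlas (R : comPzRingType) (S : open_family R)
    (P : fibre_products S) : diagram :=
  Diagram (@atlas_map R S P).

Record over (R : comPzRingType) := Over {
  over_obj :> presheaf;
  over_map : ps_hom over_obj (rep R) }.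

Definition open_over (R : comPzRingType) (W : set (spec R)) : over R :=
  @Over R (open_rep W)
    (@PsHom (open_rep W) (rep R) (fun A x => sval x)
       (fun A B f x => erefl)).

Definition open_immersion (R : comPzRingType) (U : over R) : Prop :=
  exists (S : open_family R) (P : fibre_products S) (c : cocone (atlas P) U),
    is_sheaf_colimit c /\
    forall i A (x : rep (fam_ring S i) A),
      over_map U A (c (inl i) A x) = rep_map (fam_map S i) A x.

Definition over_hom (R : comPzRingType) (V U : over R) (t : ps_hom V U) : Prop :=
  forall A (x : V A), over_map U A (t A x) = over_map V A x.

Definition over_iso (R : comPzRingType) (U V : over R) : Prop :=
  exists (t : ps_hom U V) (t' : ps_hom V U),
    [/\ over_hom t, over_hom t', forall A, cancel (t A) (t' A) &
        forall A, cancel (t' A) (t A)].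

(* From here on, subsets of a type T of sheaves, or of a locale, are written
   T -> Prop rather than set T: the type of sheaves on affine schemes is too
   large for the universe of mathcomp's sets and topological spaces. *)

Record open_subscheme (R : comPzRingType) := OpenSubscheme {
  os_class : over R -> Prop;
  os_classP : exists2 U, open_immersion U &
    os_class = (fun V => open_immersion V /\ over_iso U V) }.

Definition os_le (R : comPzRingType) (v u : open_subscheme R) : Prop :=
  exists V U : over R, [/\ os_class v V, os_class u U &
    exists t : ps_hom V U, over_hom t].

Section order.
Variables (T : Type) (le : T -> T -> Prop).

Definition is_bottom (b : T) : Prop := forall v, le b v.
Definition is_top (t : T) : Prop := forall v, le v t.
Definition is_join (A : T -> Prop) (j : T) : Prop :=
  (forall a, A a -> le a j) /\ (forall b, (forall a, A a -> le a b) -> le j b).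
Definition is_meet (A : T -> Prop) (m : T) : Prop :=
  (forall a, A a -> le m a) /\ (forall b, (forall a, A a -> le b a) -> le b m).
Definition is_finite_meet (s : seq T) (m : T) : Prop :=
  is_meet (fun a => List.In a s) m.

Record is_locale : Prop := IsLocale {
  loc_refl : forall x, le x x;
  loc_trans : forall y x z, le x y -> le y z -> le x z;
  loc_anti : forall x y, le x y -> le y x -> x = y;
  loc_join : forall A, exists j, is_join A j;
  loc_meet : forall A, exists m, is_meet A m;
  loc_distr : forall x A j m, is_join A j -> is_finite_meet [:: x; j] m ->
    is_join (fun n => exists2 a, A a & is_finite_meet [:: x; a] n) m }.

Definition principal_ideal (u : T) : T -> Prop := fun v => le v u.

Definition prime_ideal (I : T -> Prop) : Prop :=
  (exists v, ~ I v) /\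
  forall s m, (forall a, List.In a s -> ~ I a) -> is_finite_meet s m -> ~ I m.

End order.

Record locale := Locale {
  loc_sort :> Type;
  loc_le : loc_sort -> loc_sort -> Prop;
  locP : is_locale loc_le }.

(* A morphism from L to L' is a map from L' to L. *)
Record locale_hom (L L' : locale) := LocaleHom {
  pull :> L' -> L;
  pull_bottom : forall b, is_bottom (@loc_le L') b ->
    is_bottom (@loc_le L) (pull b);
  pull_top : forall t, is_top (@loc_le L') t -> is_top (@loc_le L) (pull t);
  pull_join : forall A j, is_join (@loc_le L') A j ->
    is_join (@loc_le L) (fun y => exists2 a, A a & y = pull a) (pull j);
  pull_meet : forall s m, is_finite_meet (@loc_le L') s m ->
    is_finite_meet (@loc_le L) (map pull s) (pull m) }.

Lemma bool_locale : is_locale (fun a b : bool => a ==> b).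
Proof.
split.
- by case.
- by do 3![case].
- by do 2![case].
- move=> A; exists `[< A true >]; split=> [[]// ? | b Ab].
    by apply/implyP => _; apply/asboolP.
  by apply/implyP => /asboolP /Ab.
- move=> A; exists `[< ~ A false >]; split=> [[] ? | b Ab].
  + by rewrite implybT.
  + by apply/implyP => /asboolP.
  + by apply/implyP => bT; apply/asboolP => /Ab; rewrite bT.
- move=> x A j m [jA jmin] [mxj mmax]; split.
    move=> n [a Aa [nxa _]]; apply: mmax => _ [<-|[<-|[]]].
      by apply: nxa; left.
    have := nxa a (or_intror (or_introl erefl)); have := jA _ Aa.
    by case: n {nxa} => //; case: a {Aa}.
  move=> b bub; apply/implyP => mT.
  have xT : x by have := mxj x (or_introl erefl); rewrite mT.
  have jT : j by have := mxj j (or_intror (or_introl erefl)); rewrite mT.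
  apply: contrapT => /negP/negbTE b0; have : j ==> false.
    apply: jmin => -[] // AT; rewrite -b0; apply: (bub true).
    by exists true => //; split=> [_ [<-|[<-|[]]]//|c _]; rewrite ?xT ?implybT.
  by rewrite jT.
Qed.

Definition one_loc : locale := Locale bool_locale.

Definition stone_dual (L : locale) : Type := locale_hom one_loc L.

Definition stone_open (L : locale) (W : stone_dual L -> Prop) : Prop :=
  exists u : L, forall f, W f <-> f u = true.

(* Like the locale of open subschemes, its Stone dual is too large to be a
   topologicalType, so its topology is given by the predicate stone_open. *)
Definition stone_homeomorphism (X : topologicalType) (L : locale)
    (h : X -> stone_dual L) : Prop :=
  bijective h /\
  forall W : stone_dual L -> Prop, stone_open W <-> open [set x | W (h x)].

(* Main.v *)
Require Import Defs.
From HB Require Import structures.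
From mathcomp Require Import all_boot all_order all_algebra.
From mathcomp Require Import ring.
From mathcomp Require Import all_classical topology.

Set Implicit Arguments.
Unset Strict Implicit.
Unset Printing Implicit Defensive.

Import GRing.Theory.

Local Open Scope classical_set_scope.
Local Open Scope ring_scope.

(** An open immersion of affine schemes induces isomorphisms on stalks, so a
    function on an open affine subscheme Spec B of Spec R is locally a fraction
    of elements of R. Compatible fractions glue ([glue_fractions], the statement
    that the global functions on Spec A are the elements of A), and this gives
    both the universal property of an open immersion ([osi_lift]: a morphism
    into Spec R whose image lies in Spec B factors through Spec B) and the fact
    that representable presheaves are Zariski sheaves ([rep_sheaf]).

    Consequently a family of principal opens with union W has Hom(-, W), the
    morphisms into Spec R with image in W, as the colimit of its atlas
    ([atlas_colimit]): given a cocone into a sheaf F and a morphism x from Spec A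
    to W, the space Spec A is covered by sets D(g) on which x factors through
    one of the charts; the elements of F(A[1/g]) that the cocone attaches to
    these factorizations match, and the sheaf F glues them. So the open
    immersions into Spec R are, up to isomorphism over Spec R, the sheaves
    Hom(-, W) for W open; and there is a morphism from Hom(-, V) to Hom(-, U)
    over Spec R exactly if V is contained in U, as is seen on the localizations
    R -> R[1/g] with D(g) in V. Hence the open subschemes form the locale of
    open subsets of Spec R ([os_le_open], [os_open_inj]).

    What remains is the sobriety of Spec R. A point f of the Stone dual
    determines the prime ideal of all a with f(D(a)) = 0 ([stone_prime]), and f
    is recovered from it because every open set is a union of sets D(a). *)

(** * Prime ideals and vanishing in localizations *)

Record is_ideal (R : comPzRingType) (I : set R) : Prop := IsIdeal {
  ideal0 : I 0;
  idealD : forall x y, I x -> I y -> I (x + y);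
  idealM : forall a x, I x -> I (a * x) }.

(** An ideal that contains I and is maximal among those disjoint from S is prime.
    Zorn is applied to the sets J for which I together with J is such an ideal,
    so that the empty chain needs no separate treatment. *)
Lemma prime_avoiding (R : comPzRingType) (I S : set R) :
  is_ideal I -> S 1 -> (forall x y, S x -> S y -> S (x * y)) ->
  (forall x, I x -> ~ S x) ->
  exists p : spec R, (forall x, I x -> p x) /\ (forall x, S x -> ~ p x).
Proof.
move=> idI S1 SM IS.
pose good (J : set R) := is_ideal J /\ forall x, J x -> ~ S x.
have [|J [[idJ JS] Jmax]] := @Zorn_bigcup R (fun J => good (I `|` J)).
  move=> F Fgood Ftot; split; last first.
    move=> x [/IS//|[J FJ Jx]]; have [_ h] := Fgood _ FJ.
    by apply: h; right.
  split; first by left; exact: ideal0.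
    have inF J x y : F J -> (I `|` J) x -> (I `|` J) y ->
        (I `|` \bigcup_(X in F) X) (x + y).
      move=> FJ Jx Jy; have [idJ _] := Fgood _ FJ.
      by have [?|?] := idealD idJ Jx Jy; [left|right; exists J].
    move=> x y [Ix|[J FJ Jx]] [Iy|[K FK Ky]].
    - by left; exact: idealD.
    - by apply: inF FK _ _; [left|right].
    - by apply: inF FJ _ _; [right|left].
    - have [JK|KJ] := Ftot _ _ FJ FK.
        by apply: inF FK _ _; right => //; exact: JK.
      by apply: inF FJ _ _; right => //; exact: KJ.
  move=> a x [Ix|[J FJ Jx]]; first by left; exact: idealM.
  have [idJ _] := Fgood _ FJ.
  have [] : (I `|` J) (a * x) by apply: (idealM idJ); right.
    by left.
  by right; exists J.
pose p := I `|` J.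
(* Otherwise p and x would generate a larger ideal disjoint from S. *)
have meetS x : ~ p x -> exists s a, S s /\ p (s - a * x).
  move=> npx; apply: contrapT => noS.
  pose K : set R := [set z | exists a, p (z - a * x)].
  have pK : p `<=` K by move=> z pz; exists 0; rewrite mul0r subr0.
  apply: (Jmax K).
    split=> [z Jz|KJ]; first by apply: pK; right.
    by apply: npx; right; apply: KJ; exists 1; rewrite mul1r subrr; exact: ideal0.
  have -> : I `|` K = K by apply/setUidPr => z Iz; apply: pK; left.
  split; first split.
  - by apply: pK; exact: ideal0.
  - move=> y z [a ya] [b zb]; exists (a + b).
    rewrite (_ : _ - _ = (y - a * x) + (z - b * x)); last by ring.
    exact: idealD.
  - move=> b y [a ya]; exists (b * a).
    rewrite (_ : _ - _ = b * (y - a * x)); last by ring.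
    exact: idealM.
  by move=> z [a za] Sz; apply: noS; exists z, a.
have primep : is_prime p.
  split; [exact: ideal0|exact: idealD|exact: idealM| | ].
    by move=> /JS.
  move=> x y pxy; apply: contrapT => /not_orP [/meetS[s [a [Ss sx]]]].
  move=> /meetS[t [b [St ty]]]; apply: (JS (s * t)); last exact: SM.
  rewrite -/(p _) (_ : s * t = t * (s - a * x) + ((a * x) * (t - b * y) +
    a * b * (x * y))); last by ring.
  by apply: (idealD idJ); [|apply: (idealD idJ)]; apply: (idealM idJ).
exists (Spec primep); split=> x /=; first by left.
by move=> Sx /JS.
Qed.

Lemma ideal_in_no_prime (R : comPzRingType) (I : set R) :
  is_ideal I -> (forall p : spec R, exists2 g, I g & ~ p g) -> I 1.
Proof.
move=> idI noprime; apply: contrapT => nI1.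
have [x y -> ->|x Ix x1|p [Ip _]] := @prime_avoiding R I [set 1] idI erefl.
- by rewrite /= mulr1.
- by apply: nI1; rewrite -x1.
by have [g /Ip] := noprime p.
Qed.

(** The image of x in the localization at p is 0. *)
Definition vanishes_at (R : comPzRingType) (p : spec R) (x : R) : Prop :=
  exists2 w, ~ p w & w * x = 0.

Lemma notin_primeM (R : comPzRingType) (p : spec R) x y :
  ~ p x -> ~ p y -> ~ p (x * y).
Proof. by move=> px py /(is_prime_or (specP p))[]. Qed.

Lemma notin_prime_left (R : comPzRingType) (p : spec R) x y : ~ p (x * y) -> ~ p x.
Proof. by apply: contra_not; rewrite mulrC; exact: (is_primeM (specP p)). Qed.

Lemma notin_prime_right (R : comPzRingType) (p : spec R) x y : ~ p (x * y) -> ~ p y.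
Proof. by apply: contra_not; exact: (is_primeM (specP p)). Qed.

Lemma notin_prime1 (R : comPzRingType) (p : spec R) : ~ p 1.
Proof. exact: is_prime1 (specP p). Qed.

Lemma notin_primeX (R : comPzRingType) (p : spec R) x n : ~ p x -> ~ p (x ^+ n).
Proof.
move=> px; elim: n => [|n IH]; first exact: notin_prime1.
by rewrite exprS; exact: notin_primeM.
Qed.

Lemma vanishes0 (R : comPzRingType) (p : spec R) : vanishes_at p 0.
Proof. by exists 1; [exact: notin_prime1|rewrite mulr0]. Qed.

Lemma vanishesD (R : comPzRingType) (p : spec R) x y :
  vanishes_at p x -> vanishes_at p y -> vanishes_at p (x + y).
Proof.
move=> [v pv vx] [w pw wy]; exists (v * w); first exact: notin_primeM.
rewrite (_ : _ * _ = w * (v * x) + v * (w * y)); last by ring.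
by rewrite vx wy !mulr0 addr0.
Qed.

Lemma vanishesM (R : comPzRingType) (p : spec R) a x :
  vanishes_at p x -> vanishes_at p (a * x).
Proof. by move=> [v pv vx]; exists v => //; rewrite mulrCA vx mulr0. Qed.

Lemma vanishes_cancel (R : comPzRingType) (p : spec R) a x :
  ~ p a -> vanishes_at p (a * x) -> vanishes_at p x.
Proof.
move=> pa [v pv vx]; exists (v * a); first exact: notin_primeM.
by rewrite -mulrA.
Qed.

Lemma vanishes_comap (A B : comPzRingType) (f : {rmorphism A -> B}) (q : spec B) x :
  vanishes_at (comap f q) x -> vanishes_at q (f x).
Proof. by move=> [v pv vx]; exists (f v) => //; rewrite -rmorphM vx rmorph0. Qed.

(** The annihilator of x, if disjoint from the powers of g, would lie in a
    prime of D(g). *)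
Lemma vanishes_on_basic_open (R : comPzRingType) (g x : R) :
  (forall p : spec R, ~ p g -> vanishes_at p x) -> exists n, g ^+ n * x = 0.
Proof.
move=> vx; apply: contrapT => noN.
have [||||p [annp pg]] := @prime_avoiding R [set z | z * x = 0]
    [set z | exists n, z = g ^+ n].
- split=> /= [|y z yx zx|a y yx]; first by rewrite mul0r.
    by rewrite mulrDl yx zx addr0.
  by rewrite -mulrA yx mulr0.
- by exists 0%N.
- by move=> y z [n ->] [m ->]; exists (n + m)%N; rewrite exprD.
- by move=> z zx [n zE]; apply: noN; exists n; rewrite -zE.
have [|w pw /annp//] := vx p.
by apply: pg; exists 1%N.
Qed.

Lemma vanishes_everywhere (R : comPzRingType) (x : R) :
  (forall p : spec R, vanishes_at p x) -> x = 0.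
Proof.
move=> vx; have [p _|n] := @vanishes_on_basic_open R 1 x; first exact: vx.
by rewrite expr1n mul1r.
Qed.

(** For replacing the element in a goal by a combination of elements that are
    known to vanish; the equality is then left to [ring]. *)
Lemma vanishes_eq (R : comPzRingType) (p : spec R) x y :
  vanishes_at p y -> x = y -> vanishes_at p x.
Proof. by move=> vy ->. Qed.

(** [D b c] prescribes the value b / c on the basic open set D(c), and y is the
    function with all these values. The elements g for which g times this
    function is an element of A form an ideal, and it suffices that no prime q0
    contains it. If c0 is a denominator prescribed near q0, then a power of c0
    belongs to the ideal: c0 times the function agrees with b0 on D(c0), so a
    power of c0 kills the difference near each point, and the ideal J shows that
    one power serves for all points, in place of a finite subcover. *)
Lemma glue_fractions (A : comPzRingType) (D : A -> A -> Prop) :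
  (forall q : spec A, exists b c, D b c /\ ~ q c) ->
  (forall b c b' c', D b c -> D b' c' -> forall q : spec A, ~ q c -> ~ q c' ->
    vanishes_at q (b * c' - b' * c)) ->
  exists y, forall b c, D b c -> forall q : spec A, ~ q c ->
    vanishes_at q (c * y - b).
Proof.
move=> cover compat.
pose I := [set g | exists a, forall b c, D b c -> forall q : spec A, ~ q c ->
  vanishes_at q (a * c - g * b)].
suff [y yP] : I 1.
  exists y => b c Dbc q qc; apply: (vanishes_eq (yP _ _ Dbc q qc)); ring.
apply: ideal_in_no_prime.
  split.
  - exists 0 => b c _ q _; apply: (vanishes_eq (vanishes0 q)); ring.
  - move=> g g' [a aP] [a' aP']; exists (a + a') => b c Dbc q qc.
    apply: (vanishes_eq (vanishesD (aP _ _ Dbc q qc) (aP' _ _ Dbc q qc))); ring.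
  - move=> r g [a aP]; exists (r * a) => b c Dbc q qc.
    apply: (vanishes_eq (vanishesM r (aP _ _ Dbc q qc))); ring.
move=> q0; have [b0 [c0 [D0 qc0]]] := cover q0.
(* J consists of the g such that, for some N, the function
   c0 ^+ N * (b0 - c0 * (b / c)) is 0 on D(g). *)
pose J := [set g | exists N, forall b c, D b c -> forall q : spec A,
  ~ q c -> ~ q g -> vanishes_at q (c0 ^+ N * (b0 * c - b * c0))].
suff [N NP] : J 1.
  exists (c0 ^+ N * c0); last first.
    by apply: notin_primeM => //; exact: notin_primeX.
  exists (c0 ^+ N * b0) => b c Dbc q qc.
  apply: (vanishes_eq (NP _ _ Dbc q qc (@notin_prime1 _ q))); ring.
apply: ideal_in_no_prime.
  split.
  - by exists 0%N => b c _ q _ /(_ (is_prime0 (specP q))).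
  - move=> g g' [N NP] [N' NP']; exists (N + N')%N => b c Dbc q qc qgg'.
    have [qg|qg] := pselect (q g); last first.
      apply: (vanishes_eq (vanishesM (c0 ^+ N') (NP _ _ Dbc q qc qg))).
      by rewrite exprD; ring.
    have qg' : ~ q g' by apply: contra_not qgg'; exact: (is_primeD (specP q)).
    apply: (vanishes_eq (vanishesM (c0 ^+ N) (NP' _ _ Dbc q qc qg'))).
    by rewrite exprD; ring.
  - move=> r g [N NP]; exists N => b c Dbc q qc /notin_prime_right qg.
    exact: NP.
move=> q1; have [b1 [c1 [D1 qc1]]] := cover q1.
have [|N NP] := @vanishes_on_basic_open A (c0 * c1) (b0 * c1 - b1 * c0).
  move=> q qc; apply: compat => //.
    exact: notin_prime_left qc.
  exact: notin_prime_right qc.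
exists c1 => //; exists N => b c Dbc q qc qc1'.
have v1 : vanishes_at q (c0 ^+ N * (b0 * c1 - b1 * c0)).
  apply: (@vanishes_cancel _ q (c1 ^+ N)); first exact: notin_primeX.
  apply: (vanishes_eq (vanishes0 q)); rewrite -NP exprMn; ring.
have v2 := compat _ _ _ _ D1 Dbc q qc1' qc.
apply: (@vanishes_cancel _ q c1) => //.
apply: (vanishes_eq (vanishesD (vanishesM c v1) (vanishesM (c0 ^+ N * c0) v2))).
by ring.
Qed.

(** * Open immersions and stalks *)

Lemma spec_ext (R : comPzRingType) (p q : spec R) : (forall x, p x <-> q x) -> p = q.
Proof.
case: p q => p pP [q qP] /= pq.
have E : p = q by apply/funext => x; apply/propext.
by subst q; congr Spec; exact: Prop_irrelevance.
Qed.

Definition basic_open (R : comPzRingType) (g : R) : set (spec R) := [set p | ~ p g].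

Lemma open_basicP (R : comPzRingType) (U : set (spec R)) :
  open U <-> forall p, U p -> exists2 g, ~ p g & basic_open g `<=` U.
Proof.
split=> [[E ->] p /= nE|locU].
  have [g [Eg pg]] : exists g, E g /\ ~ p g.
    apply: contrapT => noE; apply: nE => x Ex; apply: contrapT => px.
    by apply: noE; exists x.
  by exists g => // q qg /(_ g Eg).
exists [set g | basic_open g `<=` U]; apply/seteqP; split=> p /=.
  by move=> /locU[g pg gU] /(_ g gU).
move=> nE; apply: contrapT => nU; apply: nE => g gU.
by apply: contrapT => pg; apply/nU/gU.
Qed.

Lemma basic_open_open (R : comPzRingType) (g : R) : open (basic_open g).
Proof. by apply/open_basicP => p pg; exists g. Qed.

Lemma basic_openM (R : comPzRingType) (g h : R) :
  basic_open (g * h) = basic_open g `&` basic_open h.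
Proof.
apply/seteqP; split=> p /=; last by case; exact: notin_primeM.
by move=> pgh; split; [exact: notin_prime_left pgh|exact: notin_prime_right pgh].
Qed.

Lemma open_comap (A B : comPzRingType) (f : {rmorphism A -> B}) (V : set (spec A)) :
  open V -> open (comap f @^-1` V).
Proof.
move=> /open_basicP oV; apply/open_basicP => q /oV[g qg gV].
by exists (f g) => // r rg; exact: gV.
Qed.

Lemma fraction_eqP (R : comPzRingType) (p : spec R) (a s b t : R) :
  ~ p s -> ~ p t ->
  fraction_at p a s = fraction_at p b t <-> vanishes_at p (a * t - b * s).
Proof.
move=> ps pt; split=> [ab|ab].
  have : fraction_at p b t (b, t).
    by split=> //=; exists 1; rewrite ?subrr ?mulr0 //; exact: notin_prime1.
  by rewrite -ab => -[].
apply/seteqP; split=> -[x y] /= [py v]; split=> //=.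
  apply: (vanishes_cancel ps); apply: (vanishes_eq (vanishesD
    (vanishesM (- y) ab) (vanishesM t v))); rewrite /=; ring.
apply: (vanishes_cancel pt); apply: (vanishes_eq (vanishesD
  (vanishesM y ab) (vanishesM s v))); rewrite /=; ring.
Qed.

Lemma pullback_fraction (A B : comPzRingType) (f : {rmorphism A -> B})
    (q : spec B) (a s : A) : ~ q (f s) ->
  \bigcup_(x in fraction_at (comap f q) a s) fraction_at q (f x.1) (f x.2) =
  fraction_at q (f a) (f s).
Proof.
move=> qs; apply/seteqP; split=> [z [[x y] [/= qy v]]|z zas].
  suff -> : fraction_at q (f x) (f y) = fraction_at q (f a) (f s) by [].
  apply/fraction_eqP => //; rewrite -!rmorphM -rmorphB; apply: vanishes_comap.
  have {}v : vanishes_at (comap f q) (a * y - x * s) := v.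
  by apply: (vanishes_eq (vanishesM (-1) v)); ring.
exists (a, s) => //; split=> //=; exists 1; rewrite ?subrr ?mulr0 //.
exact: (@notin_prime1 _ (comap f q)).
Qed.

Definition constant_section (R : comPzRingType) (U : set (spec R)) (a : R) :
    spec R -> set (R * R) :=
  fun p => [set x | U p /\ fraction_at p a 1 x].

Lemma constant_sectionE (R : comPzRingType) (U : set (spec R)) (a : R) p :
  U p -> constant_section U a p = fraction_at p a 1.
Proof. by move=> Up; apply/seteqP; split=> x // [_]. Qed.

Lemma constant_section_out (R : comPzRingType) (U : set (spec R)) (a : R) p :
  ~ U p -> constant_section U a p = set0.
Proof. by move=> Up; apply/seteqP; split=> x // []. Qed.

Lemma constant_sectionP (R : comPzRingType) (U : set (spec R)) (a : R) :
  open U -> sections U (constant_section U a).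
Proof.
move=> oU; split; first exact: constant_section_out.
move=> p Up; exists U, a, 1; split=> // q Uq.
by split; [exact: notin_prime1|exact: constant_sectionE].
Qed.

(** The form in which affine open immersions are used: besides the topological
    conditions, f induces isomorphisms from the stalks of Spec A to those
    of Spec B, the last two fields giving surjectivity and injectivity. *)
Record open_stalk_iso (A B : comPzRingType) (f : {rmorphism A -> B}) : Prop :=
  OpenStalkIso {
    osi_injective : injective (comap f);
    osi_open : forall U, open U -> open (comap f @` U);
    osi_fraction : forall (q : spec B) b, exists a s,
      ~ q (f s) /\ vanishes_at q (f s * b - f a);
    osi_vanish : forall (q : spec B) a,
      vanishes_at q (f a) -> vanishes_at (comap f q) a }.

(** Surjectivity on stalks is read off from the section over the image of Spec B
    that corresponds to the constant section b, and injectivity from the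
    uniqueness of sections over the image of an open set D(w) on which f(a) is
    0. *)
Lemma osi_of_immersion (A B : comPzRingType) (f : {rmorphism A -> B}) :
  affine_open_immersion f -> open_stalk_iso f.
Proof.
move=> [inj opn sec]; split=> //.
  move=> q b.
  have orange : open (range (comap f)) by apply: opn; exact: openT.
  have [_ _ surj] := sec _ orange (@subset_refl _ _).
  have [|s [_ sloc] sE] := surj (constant_section (comap f @^-1` range (comap f)) b).
    by apply: constant_sectionP; exact: open_comap.
  have : fraction_at q b 1 (b, 1).
    split=> /=; first exact: notin_prime1.
    by exists 1; rewrite ?subrr ?mulr0 //; exact: notin_prime1.
  rewrite -(@constant_sectionE _ (comap f @^-1` range (comap f))); last by exists q.
  rewrite -sE => -[[x y] /= sxy [_ v]].
  exists x, y; split.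
    have [|V [c [d [_ Vq _ /(_ _ Vq)[_ sq]]]]] := sloc (comap f q); first by exists q.
    by move: sxy; rewrite sq => -[].
  by apply: (vanishes_eq (vanishesM (-1) v)); rewrite /=; ring.
move=> q a [w qw wfa].
pose W := comap f @` basic_open w.
have oW : open W by apply: opn; exact: basic_open_open.
have [|_ injs _] := sec W oW; first by move=> _ [r _ <-]; exists r.
have : constant_section W a = constant_section W 0.
  apply: injs; rewrite ?inE; [exact: constant_sectionP|exact: constant_sectionP|].
  apply/funext => r; rewrite /section_pullback.
  have [Wr|nWr] := pselect (W (comap f r)); last first.
    by rewrite !constant_section_out.
  rewrite !constant_sectionE // !pullback_fraction; try by rewrite rmorph1; exact: notin_prime1.
  apply/fraction_eqP; try by rewrite rmorph1; exact: notin_prime1.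
  have [r' r'w /inj rr] := Wr; exists w; first by rewrite -rr.
  by rewrite rmorph0 mul0r subr0 rmorph1 mulr1.
move=> /(congr1 (fun s => s (comap f q))).
rewrite !constant_sectionE; try by exists q.
move=> /fraction_eqP v; apply: (vanishes_eq (v _ _)); try exact: notin_prime1.
by ring.
Qed.

(** A section t over Spec B is locally b / c; surjectivity on stalks rewrites b
    and c, hence b / c, as fractions of elements of A (this is [chart]), and
    these fractions define the section of Spec A that t comes from. *)
Lemma immersion_of_osi (A B : comPzRingType) (f : {rmorphism A -> B}) :
  open_stalk_iso f -> affine_open_immersion f.
Proof.
move=> [inj opn frac van]; split=> // W oW Wrange; split.
- move=> s [sout sloc]; split=> [q nWq|q Wq].
    by rewrite /section_pullback sout // bigcup_set0.
  have [V [a [b [oV Vq VW sV]]]] := sloc _ Wq.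
  exists (comap f @^-1` V), (f a), (f b); split=> //.
  - exact: open_comap.
  - by move=> r; exact: VW.
  - move=> r Vr; have [rb sr] := sV _ Vr; split=> //.
    by rewrite /section_pullback sr pullback_fraction.
- move=> s s'; rewrite !inE => -[sout sloc] [s'out s'loc] ss'.
  apply/funext => p; have [Wp|nWp] := pselect (W p); last first.
    by rewrite sout ?s'out.
  have [V [a [b [_ Vp _ /(_ _ Vp)[pb sp]]]]] := sloc _ Wp.
  have [V' [a' [b' [_ V'p _ /(_ _ V'p)[pb' s'p]]]]] := s'loc _ Wp.
  have [q _ qp] := Wrange _ Wp; move: pb pb' sp s'p; rewrite -qp => pb pb' sp s'p.
  have := congr1 (fun s => s q) ss'.
  rewrite /section_pullback sp s'p !pullback_fraction // => /fraction_eqP v.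
  apply/fraction_eqP => //; apply: van; rewrite rmorphB !rmorphM; exact: v.
move=> t [tout tloc].
have chart q : W (comap f q) -> exists V a b, [/\ open V, V q,
    V `<=` comap f @^-1` W & forall r, V r -> ~ r (f b) /\
    t r = fraction_at r (f a) (f b)].
  move=> Wq; have [V [b [c [oV Vq VW tV]]]] := tloc q Wq.
  have [a [s [qs [w qw wE]]]] := frac q b.
  have [a' [s' [qs' [w' qw' w'E]]]] := frac q c.
  exists (V `&` basic_open (w * (w' * (f s * f s')))), (a * s'), (s * a').
  split.
  - by apply: openI => //; exact: basic_open_open.
  - by split=> //; do !apply: notin_primeM => //.
  - by move=> r [/VW].
  move=> r [Vr]; rewrite !basic_openM => -[/= rw [rw' [rs rs']]].
  have [rc tr] := tV _ Vr.
  have v : vanishes_at r (f s * b - f a) by exists w.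
  have v' : vanishes_at r (f s' * c - f a') by exists w'.
  have ra' : ~ r (f (s * a')).
    rewrite rmorphM; apply: notin_primeM => // ra'.
    have : r (w' * (f s' * c)).
      rewrite (_ : _ * _ = w' * (f s' * c - f a') + w' * f a'); last by ring.
      rewrite w'E add0r; exact: (is_primeM (specP r)).
    by do !apply: notin_primeM => //.
  split=> //; rewrite tr; apply/fraction_eqP => //.
  apply: (vanishes_eq (vanishesD (vanishesM (f s' * c) v)
    (vanishesM (- (f s * b)) v'))).
  by ring.
have tE p q a b (qp : comap f q = p) (qb : ~ q (f b)) :
    t q = fraction_at q (f a) (f b) ->
    [set x | [/\ W p, ~ p x.2 & exists2 r, comap f r = p & t r (f x.1, f x.2)]] =
    [set x | W p /\ fraction_at p a b x].
  move=> tq; apply/seteqP; split=> -[x y] /=.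
    move=> [Wp py [r rp]]; have -> : r = q by apply: inj; rewrite rp qp.
    rewrite tq => -[_ v]; split=> //; split=> //; move: v => /= v.
    by rewrite -qp; apply: van; rewrite rmorphB !rmorphM.
  move=> [Wp [py v]]; split=> //; exists q => //; rewrite tq; split=> /=.
    by move: py; rewrite -qp.
  by rewrite -!rmorphM -rmorphB; apply: vanishes_comap; rewrite qp.
(* The fractions over A whose images belong to the stalk value of t. *)
pose s p := [set x : A * A | [/\ W p, ~ p x.2 &
  exists2 r, comap f r = p & t r (f x.1, f x.2)]].
exists s.
  split=> [p nWp|p Wp]; first by apply/seteqP; split=> x // [].
  have [q _ qp] := Wrange _ Wp.
  have [|V [a [b [oV Vq VW tV]]]] := chart q; first by rewrite qp.
  exists (comap f @` V), a, b; split.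
  - exact: opn.
  - by exists q.
  - by move=> _ [r Vr <-]; exact: VW.
  move=> _ [r Vr <-]; have [rb tr] := tV _ Vr; split=> //.
  rewrite /s (tE _ r a b) //; apply/seteqP; split=> x /=; first by case.
  by move=> ?; split=> //; exact: VW.
apply/funext => q; rewrite /section_pullback.
have [Wq|nWq] := pselect (W (comap f q)); last first.
  rewrite tout //; apply/seteqP; split=> x // [y [Wq]]; by [].
have [V [a [b [oV Vq VW tV]]]] := chart q Wq.
have [qb tq] := tV _ Vq; rewrite tq -pullback_fraction //.
congr bigcup; rewrite /s (tE _ q a b) //.
by apply/seteqP; split=> x /=; [case|].
Qed.

(** * Rings given by representatives *)

Definition build_rmorphism (A B : comPzRingType) (h : A -> B)
    (hD : {morph h : x y / x + y}) (h0 : h 0 = 0)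
    (hM : {morph h : x y / x * y}) (h1 : h 1 = 1) : {rmorphism A -> B} :=
  GRing.RMorphism.Pack (GRing.RMorphism.Class
    (GRing.isNmodMorphism.Build A B h (conj h0 hD))
    (GRing.isMonoidMorphism.Build A B h (h1, hM))).

(** A common frame for the localizations and the pushouts below: operations on
    representatives that satisfy the axioms of a commutative ring up to a
    congruence. Since both operations are commutative, compatibility in the left
    argument is enough. *)
Record ring_presentation := RingPresentation {
  rp_sort :> Type;
  rp_eq : rp_sort -> rp_sort -> Prop;
  rp_add : rp_sort -> rp_sort -> rp_sort;
  rp_mul : rp_sort -> rp_sort -> rp_sort;
  rp_opp : rp_sort -> rp_sort;
  rp_zero : rp_sort;
  rp_one : rp_sort;
  rp_refl : forall x, rp_eq x x;
  rp_sym : forall x y, rp_eq x y -> rp_eq y x;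
  rp_trans : forall x y z, rp_eq x y -> rp_eq y z -> rp_eq x z;
  rp_addl : forall x x' y, rp_eq x x' -> rp_eq (rp_add x y) (rp_add x' y);
  rp_mull : forall x x' y, rp_eq x x' -> rp_eq (rp_mul x y) (rp_mul x' y);
  rp_oppe : forall x x', rp_eq x x' -> rp_eq (rp_opp x) (rp_opp x');
  rp_addA : forall x y z, rp_eq (rp_add x (rp_add y z)) (rp_add (rp_add x y) z);
  rp_addC : forall x y, rp_eq (rp_add x y) (rp_add y x);
  rp_add0 : forall x, rp_eq (rp_add rp_zero x) x;
  rp_addN : forall x, rp_eq (rp_add (rp_opp x) x) rp_zero;
  rp_mulA : forall x y z, rp_eq (rp_mul x (rp_mul y z)) (rp_mul (rp_mul x y) z);
  rp_mulC : forall x y, rp_eq (rp_mul x y) (rp_mul y x);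
  rp_mul1 : forall x, rp_eq (rp_mul rp_one x) x;
  rp_mulD : forall x y z,
    rp_eq (rp_mul (rp_add x y) z) (rp_add (rp_mul x z) (rp_mul y z)) }.

Definition presented (S : ring_presentation) : Type :=
  {P : S -> Prop | exists x, P = rp_eq x}.

HB.instance Definition _ (S : ring_presentation) := gen_eqMixin (presented S).
HB.instance Definition _ (S : ring_presentation) := gen_choiceMixin (presented S).

Section presented_ring.
Variable S : ring_presentation.
Implicit Types (x y : S) (u v : presented S).

Definition class_of x : presented S := exist _ (rp_eq x) (ex_intro _ x erefl).

Lemma class_eqP x y : class_of x = class_of y <-> rp_eq x y.
Proof.
split=> [/(congr1 sval)/= E|xy].
  by rewrite E; exact: rp_refl.
apply: eq_exist; apply/funext => z; apply/propext.
by split; apply: rp_trans => //; exact: rp_sym.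
Qed.

Definition repr_of u : S := projT1 (cid (svalP u)).

Lemma repr_ofK u : class_of (repr_of u) = u.
Proof. by case: u => P Pu; rewrite /repr_of; case: cid => x /= Px; exact: eq_exist. Qed.

Lemma repr_class x : rp_eq (repr_of (class_of x)) x.
Proof. by apply/class_eqP; rewrite repr_ofK. Qed.

Lemma class_of_surj (P : presented S -> Prop) :
  (forall x, P (class_of x)) -> forall u, P u.
Proof. by move=> H u; rewrite -(repr_ofK u). Qed.

Definition presented_add u v := class_of (rp_add (repr_of u) (repr_of v)).
Definition presented_mul u v := class_of (rp_mul (repr_of u) (repr_of v)).
Definition presented_opp u := class_of (rp_opp (repr_of u)).

Lemma class_add x y :
  presented_add (class_of x) (class_of y) = class_of (rp_add x y).
Proof.
apply/class_eqP; apply: rp_trans (rp_addl _ (repr_class x)) _.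
apply: rp_trans (rp_addC _ _) _; apply: rp_trans (rp_addl _ (repr_class y)) _.
exact: rp_addC.
Qed.

Lemma class_mul x y :
  presented_mul (class_of x) (class_of y) = class_of (rp_mul x y).
Proof.
apply/class_eqP; apply: rp_trans (rp_mull _ (repr_class x)) _.
apply: rp_trans (rp_mulC _ _) _; apply: rp_trans (rp_mull _ (repr_class y)) _.
exact: rp_mulC.
Qed.

Lemma class_opp x : presented_opp (class_of x) = class_of (rp_opp x).
Proof. by apply/class_eqP; apply/rp_oppe/repr_class. Qed.

Lemma presented_addA : associative presented_add.
Proof.
do 3!elim/class_of_surj => ?; rewrite !class_add; apply/class_eqP/rp_addA.
Qed.

Lemma presented_addC : commutative presented_add.
Proof.
do 2!elim/class_of_surj => ?; rewrite !class_add; apply/class_eqP/rp_addC.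
Qed.

Lemma presented_add0 : left_id (class_of (rp_zero S)) presented_add.
Proof. elim/class_of_surj => ?; rewrite class_add; apply/class_eqP/rp_add0. Qed.

Lemma presented_addN :
  left_inverse (class_of (rp_zero S)) presented_opp presented_add.
Proof.
elim/class_of_surj => ?; rewrite class_opp class_add; apply/class_eqP/rp_addN.
Qed.

HB.instance Definition _ := GRing.isZmodule.Build (presented S)
  presented_addA presented_addC presented_add0 presented_addN.

Lemma presented_mulA : associative presented_mul.
Proof.
do 3!elim/class_of_surj => ?; rewrite !class_mul; apply/class_eqP/rp_mulA.
Qed.

Lemma presented_mulC : commutative presented_mul.
Proof.
do 2!elim/class_of_surj => ?; rewrite !class_mul; apply/class_eqP/rp_mulC.
Qed.

Lemma presented_mul1 : left_id (class_of (rp_one S)) presented_mul.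
Proof. elim/class_of_surj => ?; rewrite class_mul; apply/class_eqP/rp_mul1. Qed.

Lemma presented_mulD : left_distributive presented_mul presented_add.
Proof.
do 3!elim/class_of_surj => ?; rewrite !(class_mul, class_add).
apply/class_eqP/rp_mulD.
Qed.

HB.instance Definition _ := GRing.Zmodule_isComPzRing.Build (presented S)
  presented_mulA presented_mulC presented_mul1 presented_mulD.

Lemma class_ofD x y : class_of (rp_add x y) = class_of x + class_of y.
Proof. by rewrite -class_add. Qed.

Lemma class_ofM x y : class_of (rp_mul x y) = class_of x * class_of y.
Proof. by rewrite -class_mul. Qed.

Lemma class_ofN x : class_of (rp_opp x) = - class_of x.
Proof. by rewrite -class_opp. Qed.

Lemma class_of0 : class_of (rp_zero S) = 0.
Proof. by []. Qed.

Lemma class_of1 : class_of (rp_one S) = 1.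
Proof. by []. Qed.

End presented_ring.

(** * Principal localizations *)

Section away.
Variables (R : comPzRingType) (g : R).

(** The pair (a, n) stands for a / g ^+ n. *)
Definition away_rel (x y : R * nat) : Prop :=
  exists k, g ^+ k * (x.1 * g ^+ y.2 - y.1 * g ^+ x.2) = 0.

Program Definition away_presentation : ring_presentation :=
  @RingPresentation (R * nat)%type away_rel
    (fun x y => (x.1 * g ^+ y.2 + y.1 * g ^+ x.2, (x.2 + y.2)%N))
    (fun x y => (x.1 * y.1, (x.2 + y.2)%N))
    (fun x => (- x.1, x.2)) (0, 0%N) (1, 0%N) _ _ _ _ _ _ _ _ _ _ _ _ _ _.
Next Obligation. by move=> [a n]; exists 0%N; rewrite /=; ring. Qed.
Next Obligation.
move=> [a n] [b m] [k E]; exists k; move: E => /= E.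
by rewrite -[RHS]oppr0 -E; ring.
Qed.
Next Obligation.
move=> [a n] [b m] [c l] [k E] [k' E']; exists (k + k' + m)%N => /=.
move: E E' => /= E E'.
transitivity (g ^+ k' * g ^+ l * (g ^+ k * (a * g ^+ m - b * g ^+ n)) +
  g ^+ k * g ^+ n * (g ^+ k' * (b * g ^+ l - c * g ^+ m))).
  by rewrite !exprD; ring.
by rewrite E E' !mulr0 addr0.
Qed.
Next Obligation.
move=> [a n] [b m] [c l] [k E]; exists k => /=; move: E => /= E.
transitivity (g ^+ l * g ^+ l * (g ^+ k * (a * g ^+ m - b * g ^+ n))).
  by rewrite !exprD; ring.
by rewrite E mulr0.
Qed.
Next Obligation.
move=> [a n] [b m] [c l] [k E]; exists k => /=; move: E => /= E.
transitivity (c * g ^+ l * (g ^+ k * (a * g ^+ m - b * g ^+ n))).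
  by rewrite !exprD; ring.
by rewrite E mulr0.
Qed.
Next Obligation.
move=> [a n] [b m] [k E]; exists k => /=; move: E => /= E.
by rewrite -[RHS]oppr0 -E; ring.
Qed.
Next Obligation.
by move=> [a n] [b m] [c l]; exists 0%N; rewrite /= !exprD; ring.
Qed.
Next Obligation.
by move=> [a n] [b m]; exists 0%N; rewrite /= !exprD; ring.
Qed.
Next Obligation.
by move=> [a n]; exists 0%N; rewrite /= add0n; ring.
Qed.
Next Obligation.
by move=> [a n]; exists 0%N; rewrite /= !exprD; ring.
Qed.
Next Obligation.
by move=> [a n] [b m] [c l]; exists 0%N; rewrite /= !exprD; ring.
Qed.
Next Obligation.
by move=> [a n] [b m]; exists 0%N; rewrite /= !exprD; ring.
Qed.
Next Obligation.
by move=> [a n]; exists 0%N; rewrite /= add0n; ring.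
Qed.
Next Obligation.
by move=> [a n] [b m] [c l]; exists 0%N; rewrite /= !exprD; ring.
Qed.

Definition away : comPzRingType := presented away_presentation.

Definition away_fraction (a : R) (n : nat) : away :=
  @class_of away_presentation (a, n).

Lemma to_awayD : {morph (fun a => away_fraction a 0) : x y / x + y}.
Proof.
move=> x y; rewrite -class_ofD; apply/class_eqP; exists 0%N.
by rewrite /= addn0 !expr0; ring.
Qed.

Lemma to_awayM : {morph (fun a => away_fraction a 0) : x y / x * y}.
Proof. by move=> x y; rewrite -class_ofM. Qed.

Definition to_away : {rmorphism R -> away} :=
  build_rmorphism to_awayD erefl to_awayM erefl.

Lemma away_fractionE a n : to_away (g ^+ n) * away_fraction a n = to_away a.
Proof.
rewrite -class_ofM; apply/class_eqP; exists 0%N.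
by rewrite /= add0n; ring.
Qed.

Lemma awayP (z : away) : exists a n, z = away_fraction a n.
Proof. by elim/class_of_surj: z => -[a n]; exists a, n. Qed.

Lemma to_away_eq0 a : to_away a = 0 <-> exists n, g ^+ n * a = 0.
Proof.
rewrite -[0]class_of0; split=> [/class_eqP|] [n E].
  by exists n; move: E; rewrite /= expr0 mul0r subr0 mulr1.
by apply/class_eqP; exists n; rewrite /= expr0 mul0r subr0 mulr1.
Qed.

Lemma away_denominator (r : spec away) n : ~ r (to_away (g ^+ n)).
Proof.
move=> rn; apply: (@notin_prime1 _ r).
have -> : 1 = away_fraction 1 n * to_away (g ^+ n).
  by rewrite mulrC away_fractionE rmorph1.
exact: (is_primeM (specP r)).
Qed.

(** Powers of g are invertible, so that a prime of R[1/g] is determined by the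
    numerators that it contains. *)
Lemma mem_away (r : spec away) a n : r (away_fraction a n) <-> r (to_away a).
Proof.
rewrite -(away_fractionE a n); split; first exact: (is_primeM (specP r)).
by case/(is_prime_or (specP r)) => // /away_denominator.
Qed.

Lemma away_prime (p : spec R) : ~ p g ->
  is_prime [set z : away | exists a n, z = away_fraction a n /\ p a].
Proof.
move=> pg.
have mem a n : (exists b m, away_fraction a n = away_fraction b m /\ p b) -> p a.
  move=> [b [m [/class_eqP[k /= E] pb]]]; apply: contrapT => pa.
  have : p (g ^+ k * (a * g ^+ m)).
    rewrite (_ : _ * _ = g ^+ k * (a * g ^+ m - b * g ^+ n) + g ^+ k * g ^+ n * b).
      by rewrite E add0r; exact: (is_primeM (specP p)).
    by ring.
  by do !apply: notin_primeM => //; exact: notin_primeX.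
split=> /=.
- by exists 0, 0%N; split=> //; exact: (is_prime0 (specP p)).
- move=> _ _ [a [n [-> pa]]] [b [m [-> pb]]].
  exists (a * g ^+ m + b * g ^+ n), (n + m)%N; rewrite -class_ofD; split=> //.
  by apply: (is_primeD (specP p)); rewrite mulrC; apply: (is_primeM (specP p)).
- move=> z _ [a [n [-> pa]]]; have [b [m ->]] := awayP z.
  exists (b * a), (m + n)%N; rewrite -class_ofM; split=> //.
  exact: (is_primeM (specP p)).
- by move/(mem 1 0%N); exact: notin_prime1.
move=> y z; have [a [n ->]] := awayP y; have [b [m ->]] := awayP z.
rewrite -class_ofM => /mem/(is_prime_or (specP p))[pa|pb].
  by left; exists a, n.
by right; exists b, m.
Qed.

Lemma range_to_away : range (comap to_away) = basic_open g.
Proof.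
apply/seteqP; split=> [_ [r _ <-]|p pg].
  by have := @away_denominator r 1; rewrite expr1.
exists (Spec (away_prime pg)) => //; apply: spec_ext => a /=; split; last first.
  by move=> pa; exists a, 0%N.
move=> [b [m [/class_eqP[k /= E] pb]]]; apply: contrapT => pa.
have : p (g ^+ k * (a * g ^+ m)).
  rewrite (_ : _ * _ = g ^+ k * (a * g ^+ m - b * g ^+ 0) + g ^+ k * b).
    by rewrite E add0r; exact: (is_primeM (specP p)).
  by rewrite expr0; ring.
by do !apply: notin_primeM => //; exact: notin_primeX.
Qed.

Lemma to_away_osi : open_stalk_iso to_away.
Proof.
have inj : injective (comap to_away).
  move=> r r' rr; apply: spec_ext => z; have [a [n ->]] := awayP z.
  rewrite !mem_away; change (comap to_away r a <-> comap to_away r' a).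
  by rewrite rr.
split=> // [U /open_basicP oU|r z|r a].
- apply/open_basicP => _ [r /oU[z rz zU] <-].
  have [a [n zE]] := awayP z; move: rz; rewrite zE mem_away => ra.
  exists (g * a).
    change (~ r (to_away (g * a))); rewrite rmorphM; apply: notin_primeM => //.
    by have := @away_denominator r 1; rewrite expr1.
  rewrite basic_openM -range_to_away => _ [[r' _ <-] /= r'a].
  by exists r' => //; apply: zU; rewrite zE /basic_open /= mem_away.
- have [a [n ->]] := awayP z; exists a, (g ^+ n).
  split; first exact: away_denominator.
  rewrite away_fractionE subrr; exact: vanishes0.
move=> [z rz]; have [b [n zE]] := awayP z.
move: rz; rewrite zE mem_away => rb E.
have /to_away_eq0[k kE] : to_away (b * a) = 0.
  by rewrite rmorphM -(away_fractionE b n) -mulrA E mulr0.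
exists (g ^+ k * b); last by rewrite -mulrA.
change (~ r (to_away (g ^+ k * b))); rewrite rmorphM.
by apply: notin_primeM => //; exact: away_denominator.
Qed.

End away.

(** * Pushouts of commutative rings *)

Section pushout.
Variables (A B C : comPzRingType) (f : {rmorphism A -> B}) (g : {rmorphism A -> C}).

(** The pushout is presented by generators and relations: formal ring expressions
    in the elements of B and C, modulo the congruence generated by the ring
    axioms, the operations of B and C, and the identification of the two images
    of A. *)
Inductive pushout_term : Type :=
  | PushoutL of B
  | PushoutR of C
  | PushoutAdd of pushout_term & pushout_term
  | PushoutMul of pushout_term & pushout_term
  | PushoutOpp of pushout_term.

Inductive pushout_rel : pushout_term -> pushout_term -> Prop :=
  | PushoutRefl x : pushout_rel x x
  | PushoutSym x y : pushout_rel x y -> pushout_rel y x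
  | PushoutTrans x y z : pushout_rel x y -> pushout_rel y z -> pushout_rel x z
  | PushoutAddl x x' y : pushout_rel x x' ->
      pushout_rel (PushoutAdd x y) (PushoutAdd x' y)
  | PushoutMull x x' y : pushout_rel x x' ->
      pushout_rel (PushoutMul x y) (PushoutMul x' y)
  | PushoutOppe x x' : pushout_rel x x' ->
      pushout_rel (PushoutOpp x) (PushoutOpp x')
  | PushoutAddA x y z : pushout_rel (PushoutAdd x (PushoutAdd y z))
      (PushoutAdd (PushoutAdd x y) z)
  | PushoutAddC x y : pushout_rel (PushoutAdd x y) (PushoutAdd y x)
  | PushoutAdd0 x : pushout_rel (PushoutAdd (PushoutL 0) x) x
  | PushoutAddN x : pushout_rel (PushoutAdd (PushoutOpp x) x) (PushoutL 0)
  | PushoutMulA x y z : pushout_rel (PushoutMul x (PushoutMul y z))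
      (PushoutMul (PushoutMul x y) z)
  | PushoutMulC x y : pushout_rel (PushoutMul x y) (PushoutMul y x)
  | PushoutMul1 x : pushout_rel (PushoutMul (PushoutL 1) x) x
  | PushoutMulD x y z : pushout_rel (PushoutMul (PushoutAdd x y) z)
      (PushoutAdd (PushoutMul x z) (PushoutMul y z))
  | PushoutLD x y : pushout_rel (PushoutL (x + y))
      (PushoutAdd (PushoutL x) (PushoutL y))
  | PushoutLM x y : pushout_rel (PushoutL (x * y))
      (PushoutMul (PushoutL x) (PushoutL y))
  | PushoutRD x y : pushout_rel (PushoutR (x + y))
      (PushoutAdd (PushoutR x) (PushoutR y))
  | PushoutRM x y : pushout_rel (PushoutR (x * y))
      (PushoutMul (PushoutR x) (PushoutR y))
  | PushoutGlue a : pushout_rel (PushoutL (f a)) (PushoutR (g a)).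

Definition pushout_presentation : ring_presentation :=
  RingPresentation PushoutRefl PushoutSym PushoutTrans PushoutAddl PushoutMull
    PushoutOppe PushoutAddA PushoutAddC PushoutAdd0 PushoutAddN PushoutMulA
    PushoutMulC PushoutMul1 PushoutMulD.

Definition pushout : comPzRingType := presented pushout_presentation.

Let cls := @class_of pushout_presentation.

Lemma pushout_inlD : {morph (fun x => cls (PushoutL x)) : x y / x + y}.
Proof. by move=> x y; rewrite -class_ofD; apply/class_eqP/PushoutLD. Qed.

Lemma pushout_inlM : {morph (fun x => cls (PushoutL x)) : x y / x * y}.
Proof. by move=> x y; rewrite -class_ofM; apply/class_eqP/PushoutLM. Qed.

Lemma pushout_inrD : {morph (fun x => cls (PushoutR x)) : x y / x + y}.
Proof. by move=> x y; rewrite -class_ofD; apply/class_eqP/PushoutRD. Qed.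

Lemma pushout_inrM : {morph (fun x => cls (PushoutR x)) : x y / x * y}.
Proof. by move=> x y; rewrite -class_ofM; apply/class_eqP/PushoutRM. Qed.

Lemma pushout_inr0 : cls (PushoutR 0) = 0.
Proof.
rewrite -class_of0; apply/class_eqP/PushoutSym.
by have := PushoutGlue 0; rewrite !rmorph0.
Qed.

Lemma pushout_inr1 : cls (PushoutR 1) = 1.
Proof.
rewrite -class_of1; apply/class_eqP/PushoutSym.
by have := PushoutGlue 1; rewrite !rmorph1.
Qed.

Definition pushout_inl : {rmorphism B -> pushout} :=
  build_rmorphism pushout_inlD erefl pushout_inlM erefl.

Definition pushout_inr : {rmorphism C -> pushout} :=
  build_rmorphism pushout_inrD pushout_inr0 pushout_inrM pushout_inr1.

Section universal.
Variables (T : comPzRingType) (a : {rmorphism B -> T}) (b : {rmorphism C -> T}).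

Fixpoint pushout_eval (x : pushout_term) : T :=
  match x with
  | PushoutL x => a x
  | PushoutR x => b x
  | PushoutAdd x y => pushout_eval x + pushout_eval y
  | PushoutMul x y => pushout_eval x * pushout_eval y
  | PushoutOpp x => - pushout_eval x
  end.

Hypothesis ab : a \o f =1 b \o g.

Lemma pushout_eval_rel x y : pushout_rel x y -> pushout_eval x = pushout_eval y.
Proof.
elim=> {x y} //=; try by move=> *; congruence.
all: move=> *; rewrite ?rmorphD ?rmorphM ?rmorph0 ?rmorph1; by ring.
Qed.

Definition pushout_lift_fun (u : pushout) : T := pushout_eval (repr_of u).

Lemma pushout_lift_class x : pushout_lift_fun (cls x) = pushout_eval x.
Proof. exact/pushout_eval_rel/(@repr_class pushout_presentation). Qed.

Lemma pushout_liftD : {morph pushout_lift_fun : x y / x + y}.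
Proof.
do 2!elim/class_of_surj => ?.
by rewrite -class_ofD !pushout_lift_class.
Qed.

Lemma pushout_liftM : {morph pushout_lift_fun : x y / x * y}.
Proof.
do 2!elim/class_of_surj => ?.
by rewrite -class_ofM !pushout_lift_class.
Qed.

Lemma pushout_lift0 : pushout_lift_fun 0 = 0.
Proof. by rewrite -class_of0 pushout_lift_class /= rmorph0. Qed.

Lemma pushout_lift1 : pushout_lift_fun 1 = 1.
Proof. by rewrite -class_of1 pushout_lift_class /= rmorph1. Qed.

Definition pushout_lift : {rmorphism pushout -> T} :=
  build_rmorphism pushout_liftD pushout_lift0 pushout_liftM pushout_lift1.

End universal.

Lemma pushout_fibre_product : is_fibre_product f g pushout_inl pushout_inr.
Proof.
split=> [x|T a b ab]; first exact/class_eqP/PushoutGlue.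
exists (pushout_lift ab); split.
  by split=> x /=; rewrite pushout_lift_class.
move=> c [cl cr]; apply: rmorphism_ext; elim/class_of_surj => x.
rewrite [LHS](pushout_lift_class ab).
elim: x => [x|x|x IHx y IHy|x IHx y IHy|x IHx] /=; rewrite -?cl -?cr //.
- by rewrite IHx IHy -rmorphD -class_ofD.
- by rewrite IHx IHy -rmorphM -class_ofM.
- by rewrite IHx -rmorphN -class_ofN.
Qed.

End pushout.

Lemma fibre_products_exist (R : comPzRingType) (S : open_family R) :
  inhabited (fibre_products S).
Proof.
exact: (inhabits (FibreProducts (fun i j =>
  pushout_fibre_product (fam_map S i) (fam_map S j)))).
Qed.

(** * Gluing morphisms of affine schemes *)

(** [frac_repr f b a s]: on the basic open set D(s), which is part of the image
    of Spec B, the function b is a / s. *)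
Definition frac_repr (R B : comPzRingType) (f : {rmorphism R -> B})
    (b : B) (a s : R) : Prop :=
  basic_open s `<=` range (comap f) /\
  forall q : spec B, ~ q (f s) -> vanishes_at q (f s * b - f a).

Section frac_repr.
Variables (R B : comPzRingType) (f : {rmorphism R -> B}).
Hypothesis fP : open_stalk_iso f.

Lemma frac_repr_exists b p : range (comap f) p ->
  exists a s, frac_repr f b a s /\ ~ p s.
Proof.
move=> [q _ <-]; have [a [s [qs [w qw wE]]]] := osi_fraction fP q b.
have /open_basicP : open (comap f @` basic_open w).
  by apply: osi_open fP _ _; exact: basic_open_open.
case/(_ (comap f q)); first by exists q.
move=> h qh hw; exists (h * a), (h * s); split; last exact: notin_primeM.
split=> [|r].
  by rewrite basic_openM => r [/hw[r' _ <-] _]; exists r'.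
rewrite !rmorphM => rhs; have [r' r'w /(osi_injective fP) rr] :
  (comap f @` basic_open w) (comap f r) by apply/hw; exact: notin_prime_left rhs.
apply: (@vanishes_eq _ _ _ (f h * (f s * b - f a))); last by ring.
by apply: vanishesM; exists w => //; rewrite -rr.
Qed.

Lemma frac_repr_compat b a s a' s' (p : spec R) :
  frac_repr f b a s -> frac_repr f b a' s' -> ~ p s -> ~ p s' ->
  vanishes_at p (a * s' - a' * s).
Proof.
move=> [sf bE] [_ b'E] ps ps'; have [q _ qp] := sf p ps.
move: ps ps'; rewrite -qp => /bE v /b'E v'; apply: (osi_vanish fP).
rewrite rmorphB !rmorphM.
apply: (vanishes_eq (vanishesD (vanishesM (f s) v') (vanishesM (- f s') v))).
by ring.
Qed.

Lemma frac_reprD b a s b' a' s' :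
  frac_repr f b a s -> frac_repr f b' a' s' ->
  frac_repr f (b + b') (a * s' + a' * s) (s * s').
Proof.
move=> [sf bE] [_ b'E]; split=> [|q].
  by rewrite basic_openM => p [/sf].
rewrite rmorphD !rmorphM => qss.
have v := bE q (notin_prime_left qss); have v' := b'E q (notin_prime_right qss).
apply: (vanishes_eq (vanishesD (vanishesM (f s') v) (vanishesM (f s) v'))).
by ring.
Qed.

Lemma frac_reprM b a s b' a' s' :
  frac_repr f b a s -> frac_repr f b' a' s' ->
  frac_repr f (b * b') (a * a') (s * s').
Proof.
move=> [sf bE] [_ b'E]; split=> [|q].
  by rewrite basic_openM => p [/sf].
rewrite !rmorphM => qss.
have v := bE q (notin_prime_left qss); have v' := b'E q (notin_prime_right qss).
apply: (vanishes_eq (vanishesD (vanishesM (f s' * b') v) (vanishesM (f a) v'))).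
by ring.
Qed.

Lemma frac_repr_scalar r s : basic_open s `<=` range (comap f) ->
  frac_repr f (f r) (r * s) s.
Proof.
move=> sf; split=> // q _; rewrite rmorphM mulrC subrr; exact: vanishes0.
Qed.

Lemma frac_repr_map (A : comPzRingType) (y : {rmorphism B -> A}) b a s (q : spec A) :
  frac_repr f b a s -> ~ q (y (f s)) ->
  vanishes_at q (y (f s) * y b - y (f a)).
Proof.
move=> [_ bE] qs; rewrite -rmorphM -rmorphB; apply: vanishes_comap; exact: bE.
Qed.

(** A function b on the open subscheme Spec B is locally a fraction over R. The
    images of these fractions under x glue to an element of A, and the
    uniqueness of this element makes the assignment a ring morphism. *)
Lemma osi_lift (A : comPzRingType) (x : {rmorphism R -> A}) :
  range (comap x) `<=` range (comap f) ->
  exists y : {rmorphism B -> A}, y \o f =1 x.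
Proof.
move=> xf.
have cover b (q : spec A) : exists a s, frac_repr f b a s /\ ~ q (x s).
  by apply: (@frac_repr_exists b (comap x q)); apply: xf; exists q.
have glued b : exists y, forall a s, frac_repr f b a s ->
    forall q : spec A, ~ q (x s) -> vanishes_at q (x s * y - x a).
  have [||y yP] := @glue_fractions A
    (fun c d => exists a s, [/\ frac_repr f b a s, c = x a & d = x s]).
  - move=> q; have [a [s [bE qs]]] := cover b q.
    by exists (x a), (x s); split=> //; exists a, s.
  - move=> _ _ _ _ [a [s [bE -> ->]]] [a' [s' [bE' -> ->]]] q qs qs'.
    rewrite -!rmorphM -rmorphB; apply: vanishes_comap.
    exact: frac_repr_compat bE bE' _ _.
  by exists y => a s bE q; apply: yP; exists a, s.
have [h hP] := choice glued.
have uniq b z : (forall q : spec A, exists a s,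
    [/\ frac_repr f b a s, ~ q (x s) & vanishes_at q (x s * z - x a)]) -> h b = z.
  move=> zP; apply/subr0_eq/vanishes_everywhere => q.
  have [a [s [bE qs v]]] := zP q; apply: (vanishes_cancel qs).
  apply: (vanishes_eq (vanishesD (hP b a s bE q qs) (vanishesM (-1) v))); ring.
have hf r : h (f r) = x r.
  apply: uniq => q; have [_ [s [[sf _] qs]]] := cover 0 q.
  exists (r * s), s; split=> //; first exact: frac_repr_scalar.
  rewrite rmorphM mulrC subrr; exact: vanishes0.
have hD : {morph h : b b' / b + b'}.
  move=> b b'; apply: uniq => q.
  have [a [s [bE qs]]] := cover b q; have [a' [s' [bE' qs']]] := cover b' q.
  exists (a * s' + a' * s), (s * s'); split; first exact: frac_reprD.
    by rewrite rmorphM; exact: notin_primeM.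
  rewrite rmorphD !rmorphM; apply: (vanishes_eq (vanishesD
    (vanishesM (x s') (hP b a s bE q qs)) (vanishesM (x s) (hP b' a' s' bE' q qs')))).
  by ring.
have hM : {morph h : b b' / b * b'}.
  move=> b b'; apply: uniq => q.
  have [a [s [bE qs]]] := cover b q; have [a' [s' [bE' qs']]] := cover b' q.
  exists (a * a'), (s * s'); split; first exact: frac_reprM.
    by rewrite rmorphM; exact: notin_primeM.
  rewrite !rmorphM; apply: (vanishes_eq (vanishesD
    (vanishesM (x s' * h b') (hP b a s bE q qs))
    (vanishesM (x a) (hP b' a' s' bE' q qs')))).
  by ring.
have h0 : h 0 = 0 by rewrite -(rmorph0 f) hf rmorph0.
have h1 : h 1 = 1 by rewrite -(rmorph1 f) hf rmorph1.
by exists (build_rmorphism hD h0 hM h1).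
Qed.

End frac_repr.

Lemma fam_osi (R : comPzRingType) (S : open_family R) i : open_stalk_iso (fam_map S i).
Proof. exact/osi_of_immersion/fam_open. Qed.

(** The matching condition concerns the fibre products; any pair of morphisms that
    agrees over R factors through one of these. *)
Lemma matching_over (R : comPzRingType) (S : open_family R) (F : presheaf)
    (x : forall i, F (fam_ring S i)) i j (T : comPzRingType)
    (y : {rmorphism fam_ring S i -> T}) (y' : {rmorphism fam_ring S j -> T}) :
  matching x -> y \o fam_map S i =1 y' \o fam_map S j ->
  ps_map y (x i) = ps_map y' (x j).
Proof.
move=> mx yy'.
have fp := pushout_fibre_product (fam_map S i) (fam_map S j).
have [c [[cl cr] _]] := fp.2 T y y' yy'.
have -> : y = c \o pushout_inl (fam_map S i) (fam_map S j).
  by apply: rmorphism_ext => z; rewrite -cl.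
have -> : y' = c \o pushout_inr (fam_map S i) (fam_map S j).
  by apply: rmorphism_ext => z; rewrite -cr.
by rewrite !ps_comp (mx _ _ _ _ _ fp).
Qed.

(** For c in C, the functions x i c are locally fractions over R. Two of these
    fractions, for indices i and j and denominators s and s', agree on D(s * s'):
    there both charts map to R[1/(s * s')], where [matching_over] compares them.
    So they glue to an element of R. *)
Lemma rep_sheaf (C : comPzRingType) : is_sheaf (rep C).
Proof.
move=> R S Ssurj x mx.
have sep z z' : (forall i, fam_map S i z = fam_map S i z') -> z = z'.
  move=> zz'; apply/subr0_eq/vanishes_everywhere => p.
  have [i [q _ <-]] := Ssurj p; apply: (osi_vanish (fam_osi i)).
  rewrite rmorphB zz' subrr; exact: vanishes0.
have glued c : exists y, forall i, fam_map S i y = x i c.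
  have cover (p : spec R) : exists i a s, frac_repr (fam_map S i) (x i c) a s /\ ~ p s.
    have [i pi] := Ssurj p; exists i.
    exact: (frac_repr_exists (fam_osi i)).
  have [||y yP] := @glue_fractions R
    (fun a s => exists i, frac_repr (fam_map S i) (x i c) a s).
  - by move=> p; have [i [a [s [aE ps]]]] := cover p; exists a, s; split=> //; exists i.
  - move=> a s a' s' [i aE] [j a'E] p ps ps'.
    have ss'E : range (comap (to_away (s * s'))) = basic_open s `&` basic_open s'.
      by rewrite range_to_away basic_openM.
    have [|y yE] := @osi_lift _ _ _ (fam_osi i) _ (to_away (s * s')).
      by rewrite ss'E => r [/(proj1 aE)].
    have [|y' y'E] := @osi_lift _ _ _ (fam_osi j) _ (to_away (s * s')).
      by rewrite ss'E => r [_ /(proj1 a'E)].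
    have /(congr1 (fun k : {rmorphism C -> _} => k c)) /= yy' :=
      @matching_over _ _ _ _ _ _ _ y y' mx (fun z => etrans (yE z) (esym (y'E z))).
    have [r _ rp] : range (comap (to_away (s * s'))) p by rewrite ss'E.
    move: ps ps'; rewrite -rp => rs rs'; apply: (osi_vanish (to_away_osi _)).
    have := @frac_repr_map _ _ _ _ y _ _ _ r aE.
    have := @frac_repr_map _ _ _ _ y' _ _ _ r a'E.
    rewrite -yy' -[y (fam_map S i s)]/((y \o _) s) -[y (fam_map S i a)]/((y \o _) a).
    rewrite -[y' (fam_map S j s')]/((y' \o _) s') -[y' (fam_map S j a')]/((y' \o _) a').
    rewrite !yE !y'E => /(_ rs') v' /(_ rs) v; rewrite rmorphB !rmorphM.
    apply: (vanishes_eq (vanishesD (vanishesM (to_away (s * s') s) v')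
      (vanishesM (- to_away (s * s') s') v))).
    by ring.
  exists y => i; apply/subr0_eq/vanishes_everywhere => q.
  have [|a [s [aE qs]]] := @frac_repr_exists _ _ _ (fam_osi i) (x i c)
    (comap (fam_map S i) q); first by exists q.
  have {}qs : ~ q (fam_map S i s) := qs.
  have v : vanishes_at (comap (fam_map S i) q) (s * y - a).
    by apply: yP => //; exists i.
  apply: (vanishes_cancel qs); apply: (vanishes_eq (vanishesD
    (vanishes_comap v) (vanishesM (-1) (aE.2 q qs)))).
  by rewrite rmorphB rmorphM; ring.
have [h hP] := choice glued.
have hD : {morph h : c c' / c + c'}.
  by move=> c c'; apply: sep => i; rewrite rmorphD !hP rmorphD.
have hM : {morph h : c c' / c * c'}.
  by move=> c c'; apply: sep => i; rewrite rmorphM !hP rmorphM.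
have h0 : h 0 = 0 by apply: sep => i; rewrite hP !rmorph0.
have h1 : h 1 = 1 by apply: sep => i; rewrite hP !rmorph1.
exists (build_rmorphism hD h0 hM h1 : {rmorphism C -> R}); split.
  by move=> i; apply: rmorphism_ext => c; exact: hP.
move=> y yE; apply: rmorphism_ext => c; apply: sep => i.
by rewrite [LHS]hP -yE.
Qed.

Lemma open_rep_ext (R A : comPzRingType) (W : set (spec R)) (x y : open_rep W A) :
  sval x = sval y -> x = y.
Proof. by case: x y => [x xW] [y yW] /= xy; exact: eq_exist. Qed.

Lemma open_rep_sheaf (R : comPzRingType) (W : set (spec R)) : is_sheaf (open_rep W).
Proof.
move=> A S Ssurj x mx.
have [|y [yE yuniq]] := rep_sheaf Ssurj (x := fun i => sval (x i)).
  by move=> i j P p q /mx /(congr1 sval).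
have yW : range (comap y) `<=` W.
  move=> _ [p _ <-]; have [i [q _ <-]] := Ssurj p.
  apply: (svalP (x i)); exists q => //; rewrite -(yE i); exact: comap_comp.
exists (exist _ y yW); split=> [i|[z zW] zE].
  by apply: open_rep_ext; exact: yE.
by apply: open_rep_ext; apply: yuniq => i; rewrite -(zE i).
Qed.

(** * Morphisms of presheaves and colimits *)

Lemma ps_hom_ext (F G : presheaf) (s t : ps_hom F G) :
  (forall A (x : F A), s A x = t A x) -> s = t.
Proof.
case: s t => [s sN] [t tN] /= st.
have E : s = t by do 2!apply: functional_extensionality_dep => ?; exact: st.
by subst t; congr PsHom; exact: Prop_irrelevance.
Qed.

Program Definition ps_hom_comp (F G H : presheaf) (t : ps_hom G H) (s : ps_hom F G) :
    ps_hom F H :=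
  @PsHom F H (fun A x => t A (s A x)) _.
Next Obligation. by move=> F G H t s A B f x /=; rewrite !ps_natural. Qed.

Definition ps_hom_id (F : presheaf) : ps_hom F F :=
  @PsHom F F (fun A x => x) (fun A B f x => erefl).

Program Definition cocone_comp (D : diagram) (F G : presheaf) (t : ps_hom F G)
    (c : cocone D F) : cocone D G :=
  @Cocone D G (fun v => ps_hom_comp t (c v)) _.
Next Obligation. by move=> D F G t c v w e A x /=; rewrite leg_comm. Qed.

Lemma colimit_hom_ext (D : diagram) (F G : presheaf) (c : cocone D F)
    (s t : ps_hom F G) :
  is_sheaf_colimit c -> is_sheaf G ->
  (forall v A (x : dg_obj v A), s A (c v A x) = t A (c v A x)) -> s = t.
Proof.
move=> [_ univ] shG st.
have [u [_ uuniq]] := univ G (cocone_comp t c) shG.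
by rewrite -(uuniq s) ?(uuniq t).
Qed.

Lemma sheaf_separated (F : presheaf) (R : comPzRingType) (S : open_family R) :
  is_sheaf F -> jointly_surjective S -> forall z z' : F R,
  (forall i, ps_map (fam_map S i) z = ps_map (fam_map S i) z') -> z = z'.
Proof.
move=> shF Ssurj z z' zz'.
have [|y [_ yuniq]] := shF R S Ssurj (fun i => ps_map (fam_map S i) z').
  move=> i j P p q [pq _]; rewrite -!ps_comp.
  by congr ps_map; apply: rmorphism_ext.
by rewrite -(yuniq z) ?(yuniq z').
Qed.

(** * The colimit of an atlas *)

Definition away_family (R : comPzRingType) (G : R -> Prop) : open_family R :=
  @OpenFamily R {g | G g} (fun g => away (sval g)) (fun g => to_away (sval g))
    (fun g => immersion_of_osi (to_away_osi (sval g))).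

Definition fam_image (R : comPzRingType) (S : open_family R) : set (spec R) :=
  [set p | exists i, range (comap (fam_map S i)) p].

Lemma away_family_image (R : comPzRingType) (G : R -> Prop) :
  fam_image (away_family G) = \bigcup_(g in [set g | G g]) basic_open g.
Proof.
apply/seteqP; split=> [p [[g Gg] /= pg]|p [g Gg pg]].
  by exists g => //; rewrite -range_to_away; exact: pg.
exists (exist _ g Gg); change (range (comap (to_away g)) p).
by rewrite range_to_away.
Qed.

Lemma open_fam_image (R : comPzRingType) (S : open_family R) : open (fam_image S).
Proof.
apply/open_basicP => p [i pi].
have /open_basicP : open (range (comap (fam_map S i))).
  by apply: (osi_open (fam_osi i)); exact: openT.
by case/(_ p pi) => g pg gi; exists g => // q /gi ?; exists i.
Qed.

Section atlas_colimit.
Variables (R : comPzRingType) (S : open_family R) (P : fibre_products S).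
Let W := fam_image S.

Lemma range_comap_comp (A B : comPzRingType) (f : {rmorphism R -> A}) (g : {rmorphism A -> B}) :
  range (comap (g \o f : {rmorphism R -> B})) `<=` range (comap f).
Proof. by move=> _ [q _ <-]; rewrite comap_comp; exists (comap g q). Qed.

Lemma fam_map_image i : range (comap (fam_map S i)) `<=` W.
Proof. by move=> p pi; exists i. Qed.

Lemma fib_map_image i j : range (comap
  (fib_fst P i j \o fam_map S i : {rmorphism R -> fib_ring P i j})) `<=` W.
Proof. exact: subset_trans (@range_comap_comp _ _ _ _) (@fam_map_image i). Qed.

Program Definition rep_to_open (B : comPzRingType) (f : {rmorphism R -> B})
    (fW : range (comap f) `<=` W) : ps_hom (rep B) (open_rep W) :=
  @PsHom (rep B) (open_rep W)
    (fun A x => exist _ (x \o f : {rmorphism R -> A})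
      (subset_trans (@range_comap_comp _ _ f x) fW)) _.
Next Obligation. by move=> *; apply: open_rep_ext; apply: rmorphism_ext. Qed.

Definition atlas_leg v : ps_hom (atlas_obj P v) (open_rep W) :=
  match v with
  | inl i => rep_to_open (@fam_map_image i)
  | inr ij => rep_to_open (@fib_map_image ij.1 ij.2)
  end.

Lemma atlas_leg_comm v w (e : atlas_arrow v w) A (x : atlas_obj P v A) :
  atlas_leg w A (atlas_map P e A x) = atlas_leg v A x.
Proof.
case: e x => i j x; apply: open_rep_ext; apply: rmorphism_ext => // r /=.
by have [/(_ r)/= -> _] := fibP P i j.
Qed.

Definition atlas_cocone : cocone (atlas P) (open_rep W) :=
  @Cocone (atlas P) (open_rep W) atlas_leg atlas_leg_comm.

Section universal.
Variables (F : presheaf) (shF : is_sheaf F) (d : cocone (atlas P) F).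

(** The cocone d on the charts, with its argument typed as a ring morphism. *)
Let dd i (T : comPzRingType) (y : {rmorphism fam_ring S i -> T}) : F T :=
  d (inl i) T y.

Lemma dd_natural i (T U : comPzRingType) (h : {rmorphism T -> U})
    (y : {rmorphism fam_ring S i -> T}) :
  ps_map h (dd y) = dd (h \o y : {rmorphism fam_ring S i -> U}).
Proof. by rewrite /dd -(ps_natural (d (inl i))). Qed.

(** The two morphisms factor together through the fibre product of the
    charts, where the legs of d agree. *)
Lemma dd_over i j (T : comPzRingType) (y : {rmorphism fam_ring S i -> T})
    (y' : {rmorphism fam_ring S j -> T}) :
  y \o fam_map S i =1 y' \o fam_map S j -> dd y = dd y'.
Proof.
move=> yy'; have [_ /(_ T y y' yy')[c [[cl cr] _]]] := fibP P i j.
have := leg_comm d (AtlasFst i j) (c : rep (fib_ring P i j) T).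
have := leg_comm d (AtlasSnd i j) (c : rep (fib_ring P i j) T).
rewrite /dd => <- /= E; transitivity (d (inl i) T (c \o fib_fst P i j : {rmorphism _ -> _})).
  by congr (d (inl i) T _); apply: rmorphism_ext => z; rewrite -cl.
rewrite [LHS]E; congr (d (inl j) T _); apply: rmorphism_ext => z; exact: cr.
Qed.

(** The element z is the value at x of the morphism induced by d. Quantifying over
    all T on which x factors through a chart, and not only over the members of
    one cover of Spec A, makes this condition visibly natural in A. *)
Definition induced_value (A : comPzRingType) (x : open_rep W A) (z : F A) : Prop :=
  forall (T : comPzRingType) (h : {rmorphism A -> T}) i
    (y : {rmorphism fam_ring S i -> T}),
  y \o fam_map S i =1 h \o sval x -> ps_map h z = dd y.

Let chart_at (A : comPzRingType) (x : open_rep W A) (g : A) : Prop :=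
  exists i, basic_open g `<=` comap (sval x) @^-1` range (comap (fam_map S i)).

Lemma chart_family_surj (A : comPzRingType) (x : open_rep W A) :
  jointly_surjective (away_family (chart_at x)).
Proof.
move=> q; change (fam_image (away_family (chart_at x)) q).
rewrite away_family_image.
have [i qi] : W (comap (sval x) q) by apply: (svalP x); exists q.
have /open_basicP : open (comap (sval x) @^-1` range (comap (fam_map S i))).
  by apply/open_comap/(osi_open (fam_osi i)); exact: openT.
by case/(_ q qi) => g qg gi; exists g => //; exists i.
Qed.

Lemma chart_factor (A : comPzRingType) (x : open_rep W A)
    (k : fam_index (away_family (chart_at x))) :
  exists i (y : {rmorphism fam_ring S i -> away (sval k)}),
    y \o fam_map S i =1 to_away (sval k) \o sval x.
Proof.
case: k => g [i gi] /=; exists i; apply: (@osi_lift _ _ _ (fam_osi i) _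
  (to_away g \o sval x : {rmorphism R -> away g})) => _ [r _ <-].
rewrite comap_comp; apply: gi; rewrite -range_to_away; by exists r.
Qed.

Lemma induced_value_unique (A : comPzRingType) (x : open_rep W A) (z z' : F A) :
  induced_value x z -> induced_value x z' -> z = z'.
Proof.
move=> zP z'P; apply: (sheaf_separated shF (@chart_family_surj _ x)) => k.
have [i [y yE]] := chart_factor k.
by rewrite (zP _ _ _ _ yE) (z'P _ _ _ _ yE).
Qed.

(** Gluing over the cover of Spec A by charts gives z. To verify the condition for
    a morphism h from A to T, the cover is pulled back to T along h, and F is
    separated. *)
Lemma induced_value_exists (A : comPzRingType) (x : open_rep W A) :
  exists z, induced_value x z.
Proof.
pose K := away_family (chart_at x).
pose i (k : fam_index K) := projT1 (cid (chart_factor k)).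
pose y (k : fam_index K) : {rmorphism fam_ring S (i k) -> fam_ring K k} :=
  projT1 (cid (projT2 (cid (chart_factor k)))).
have yE k : y k \o fam_map S (i k) =1 to_away (sval k) \o sval x.
  exact: projT2 (cid (projT2 (cid (chart_factor k)))).
have [|z [zE _]] := shF (@chart_family_surj _ x) (x := fun k => dd (y k)).
  move=> k l Q p q [pq _]; rewrite !dd_natural; apply: dd_over => r /=.
  have /= -> := yE k r; have /= -> := yE l r; exact: pq.
exists z => T h j w wE.
pose G := [set t | exists2 g, chart_at x g & t = h g].
have Gsurj : jointly_surjective (away_family G).
  move=> q; change (fam_image (away_family G) q).
  rewrite away_family_image.
  have : fam_image K (comap h q) by exact: chart_family_surj.
  by rewrite away_family_image => -[g gx qg]; exists (h g) => //; exists g.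
apply: (sheaf_separated shF Gsurj) => -[t Gt].
change (ps_map (to_away t) (ps_map h z) = ps_map (to_away t) (dd w)).
case: Gt => g gx ->.
pose k : fam_index K := exist _ g gx.
have [|u uE] := @osi_lift _ _ _ (to_away_osi g) _
    (to_away (h g) \o h : {rmorphism A -> away (h g)}).
  move=> _ [r _ <-]; rewrite comap_comp range_to_away /basic_open /=.
  have := @away_denominator _ (h g) r 1; by rewrite expr1.
transitivity (ps_map u (ps_map (to_away g) z)).
  by rewrite -!ps_comp; congr ps_map; apply: rmorphism_ext => a; rewrite -uE.
rewrite (zE k) !dd_natural; apply: dd_over => r /=.
have /= -> := yE k r; have /= -> := wE r; exact: uE.
Qed.

Definition induced_fun (A : comPzRingType) (x : open_rep W A) : F A :=
  projT1 (cid (induced_value_exists x)).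

Lemma induced_funP (A : comPzRingType) (x : open_rep W A) :
  induced_value x (induced_fun x).
Proof. exact: projT2 (cid (induced_value_exists x)). Qed.

Lemma induced_fun_natural (A B : comPzRingType) (f : {rmorphism A -> B})
    (x : open_rep W A) :
  induced_fun (ps_map f x) = ps_map f (induced_fun x).
Proof.
refine (induced_value_unique (@induced_funP B (ps_map f x)) _) => T h i y yE.
by rewrite -ps_comp; exact: induced_funP.
Qed.

Definition induced_hom : ps_hom (open_rep W) F :=
  @PsHom (open_rep W) F induced_fun induced_fun_natural.

Lemma induced_hom_leg v A (x : atlas_obj P v A) :
  induced_hom A (atlas_leg v A x) = d v A x.
Proof.
have legl i (y : {rmorphism fam_ring S i -> A}) :
    induced_hom A (atlas_leg (inl i) A y) = d (inl i) A y.
  by rewrite -[LHS]ps_id; exact: induced_funP.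
case: v x => [i|[i j]] x; first exact: legl.
transitivity (induced_hom A (atlas_leg (inl i) A (atlas_map P (AtlasFst i j) A x))).
  by rewrite atlas_leg_comm.
by rewrite legl; exact: (leg_comm d (AtlasFst i j)).
Qed.

Lemma induced_hom_unique (t : ps_hom (open_rep W) F) :
  (forall v A (x : atlas_obj P v A), t A (atlas_leg v A x) = d v A x) ->
  induced_hom = t.
Proof.
move=> tP; apply: ps_hom_ext => A x.
refine (induced_value_unique (@induced_funP A x) _) => T h i y yE.
rewrite -ps_natural /dd -tP; congr (t T _).
by apply: open_rep_ext; apply: rmorphism_ext => r; exact: esym (yE r).
Qed.

End universal.

Lemma atlas_colimit : is_sheaf_colimit atlas_cocone.
Proof.
split=> [|F d shF]; first exact: open_rep_sheaf.
exists (induced_hom shF d); split; first exact: induced_hom_leg.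
exact: induced_hom_unique.
Qed.

Lemma open_immersion_fam_image : open_immersion (open_over W).
Proof. by exists S, P, atlas_cocone; split; first exact: atlas_colimit. Qed.

(** Both sheaves over Spec R are colimits of the atlas. *)
Lemma colimit_over_iso (U : Defs.over R) (c : cocone (atlas P) U) :
  is_sheaf_colimit c ->
  (forall i A (x : rep (fam_ring S i) A),
     over_map U A (c (inl i) A x) = rep_map (fam_map S i) A x) ->
  over_iso U (open_over W).
Proof.
move=> colimc cE.
have [t [tE _]] := colimc.2 _ atlas_cocone atlas_colimit.1.
have [t' [t'E _]] := atlas_colimit.2 _ c colimc.1.
have t'K : ps_hom_comp t' t = ps_hom_id U.
  by apply: (colimit_hom_ext colimc colimc.1) => v A x /=; rewrite tE t'E.
have tK : ps_hom_comp t t' = ps_hom_id (open_rep W).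
  by apply: (colimit_hom_ext atlas_colimit atlas_colimit.1) => v A x /=; rewrite t'E tE.
have tover : ps_hom_comp (over_map (open_over W)) t = over_map U.
  apply: (colimit_hom_ext colimc (@rep_sheaf R)) => v A x.
  change (over_map (open_over W) A (t A (c v A x)) = over_map U A (c v A x)).
  case: v x => [i|[i j]] x; first by rewrite tE cE.
  rewrite -(leg_comm c (AtlasFst i j)) tE cE.
  by apply: rmorphism_ext.
have K A x : t' A (t A x) = x := congr1 (fun s : ps_hom U U => s A x) t'K.
have K' A x : t A (t' A x) = x :=
  congr1 (fun s : ps_hom (open_rep W) (open_rep W) => s A x) tK.
have tO A x : over_map (open_over W) A (t A x) = over_map U A x :=
  congr1 (fun s : ps_hom U (rep R) => s A x) tover.
by exists t, t'; split=> // A x; rewrite -tO K'.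
Qed.

End atlas_colimit.

(** * Open immersions are open subsets *)

(** W is the union of the sets D(g) that it contains. *)
Lemma open_immersion_open (R : comPzRingType) (W : set (spec R)) :
  open W -> open_immersion (open_over W).
Proof.
move=> /open_basicP oW; pose S := away_family [set g | basic_open g `<=` W].
have <- : fam_image S = W.
  rewrite away_family_image; apply/seteqP; split=> [p [g gW]|p /oW[g pg gW]].
    exact: gW.
  by exists g.
have [P] := fibre_products_exist S; exact: open_immersion_fam_image P.
Qed.

Lemma open_immersion_iso (R : comPzRingType) (U : Defs.over R) :
  open_immersion U -> exists2 W, open W & over_iso U (open_over W).
Proof.
move=> [S [P [c [colimc cE]]]]; exists (fam_image S); first exact: open_fam_image.
exact: colimit_over_iso colimc cE.
Qed.

(** A morphism over Spec R from V to U is inclusion: test it on the points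
    R -> R[1/g] with D(g) in V. *)
Lemma over_hom_open (R : comPzRingType) (V U : set (spec R)) : open V ->
  (exists t : ps_hom (open_over V) (open_over U), over_hom t) <-> V `<=` U.
Proof.
move=> /open_basicP oV; split=> [[t tover] p /oV[g pg gV]|VU].
  have gV' : range (comap (to_away g)) `<=` V by rewrite range_to_away.
  have tg := tover (away g) (exist _ (to_away g) gV').
  have := svalP (t (away g) (exist _ (to_away g) gV')).
  by move: tg; rewrite /over_map /= => ->; apply; rewrite range_to_away.
have sub (A : comPzRingType) (x : open_rep V A) : range (comap (sval x)) `<=` U.
  exact: subset_trans (svalP x) VU.
have nat (A B : comPzRingType) (f : {rmorphism A -> B}) (x : open_rep V A) :
    exist _ (sval (ps_map f x)) (sub B (ps_map f x)) =
    ps_map f (exist _ (sval x) (sub A x) : open_rep U A).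
  exact: open_rep_ext.
by exists (@PsHom (open_rep V) (open_rep U) (fun A x => exist _ (sval x) (sub A x)) nat).
Qed.

(** * Open subschemes *)

Section over_iso.
Variable R : comPzRingType.
Implicit Types U V W : Defs.over R.

Lemma over_hom_comp U V W (s : ps_hom U V) (t : ps_hom V W) :
  over_hom s -> over_hom t -> over_hom (ps_hom_comp t s : ps_hom U W).
Proof. by move=> sO tO A x /=; rewrite tO sO. Qed.

Lemma over_iso_refl U : over_iso U U.
Proof. by exists (ps_hom_id U), (ps_hom_id U); split. Qed.

Lemma over_iso_sym U V : over_iso U V -> over_iso V U.
Proof. by move=> [t [t' [tO t'O tK t'K]]]; exists t', t; split. Qed.

Lemma over_iso_trans U V W : over_iso U V -> over_iso V W -> over_iso U W.
Proof.
move=> [s [s' [sO s'O sK s'K]]] [t [t' [tO t'O tK t'K]]].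
exists (ps_hom_comp t s), (ps_hom_comp s' t').
split; [exact: over_hom_comp|exact: over_hom_comp| |] => A x /=.
  by rewrite tK sK.
by rewrite s'K t'K.
Qed.

Lemma over_iso_hom U V : over_iso U V -> exists t : ps_hom U V, over_hom t.
Proof. by move=> [t [_ [tO _ _ _]]]; exists t. Qed.

End over_iso.

Section open_subschemes.
Variable R : comPzRingType.
Implicit Types (u v : open_subscheme R) (W : set (spec R)).

Lemma os_class_hom u (U V : Defs.over R) : os_class u U -> os_class u V ->
  exists t : ps_hom U V, over_hom t.
Proof.
have [U0 _ ->] := os_classP u; move=> [_ /over_iso_sym/over_iso_hom[s sO]].
move=> [_ /over_iso_hom[t tO]]; exists (ps_hom_comp t s); exact: over_hom_comp.
Qed.

(** The set W is unique by [os_class_inj], so this is the W for which the class of u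
    contains Hom(-, W). *)
Definition os_open u : set (spec R) :=
  [set p | exists W, [/\ open W, os_class u (open_over W) & W p]].

Lemma os_class_inj u W W' : open W -> open W' ->
  os_class u (open_over W) -> os_class u (open_over W') -> W = W'.
Proof.
move=> oW oW' uW uW'; apply/seteqP.
split; apply/over_hom_open => //; first exact: os_class_hom uW uW'.
exact: os_class_hom uW' uW.
Qed.

Lemma os_open_eq u W : open W -> os_class u (open_over W) -> os_open u = W.
Proof.
move=> oW uW; apply/seteqP; split=> [p [W' [oW' uW' W'p]]|p Wp]; last by exists W.
by rewrite (os_class_inj oW oW' uW uW').
Qed.

Lemma os_openP u : open (os_open u) /\ os_class u (open_over (os_open u)).
Proof.
suff [W oW uW] : exists2 W, open W & os_class u (open_over W).
  by rewrite (os_open_eq oW uW).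
have [U Uimm ->] := os_classP u; have [W oW UW] := open_immersion_iso Uimm.
by exists W => //; split=> //; exact: open_immersion_open.
Qed.

Lemma os_le_open v u : os_le v u <-> os_open v `<=` os_open u.
Proof.
have [oV vV] := os_openP v; have [oU uU] := os_openP u.
split=> [[V [U [vV' uU' [t tO]]]]|vu].
  have [r rO] := os_class_hom vV vV'; have [s sO] := os_class_hom uU' uU.
  apply/over_hom_open => //; exists (ps_hom_comp s (ps_hom_comp t r)).
  by apply: over_hom_comp sO; exact: over_hom_comp tO.
exists (open_over (os_open v)), (open_over (os_open u)); split=> //.
exact/over_hom_open.
Qed.

Lemma open_subscheme_of_subproof W : open W -> exists2 U, open_immersion U &
  (fun V => open_immersion V /\ over_iso (open_over W) V) =
  (fun V => open_immersion V /\ over_iso U V).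
Proof. by move=> oW; exists (open_over W) => //; exact: open_immersion_open. Qed.

Definition open_subscheme_of W (oW : open W) : open_subscheme R :=
  OpenSubscheme (open_subscheme_of_subproof oW).

Lemma open_subscheme_of_class W (oW : open W) :
  os_class (open_subscheme_of oW) (open_over W).
Proof. by split; [exact: open_immersion_open|exact: over_iso_refl]. Qed.

Lemma open_subscheme_ofK W (oW : open W) : os_open (open_subscheme_of oW) = W.
Proof. exact: os_open_eq (open_subscheme_of_class oW). Qed.

Lemma os_class_iso u (U : Defs.over R) V :
  os_class u U -> os_class u V <-> open_immersion V /\ over_iso U V.
Proof.
have [U0 _ ->] := os_classP u; move=> [Uimm U0U]; split=> -[Vimm UV]; split=> //.
  exact: over_iso_trans (over_iso_sym U0U) UV.
exact: over_iso_trans U0U UV.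
Qed.

Lemma os_open_inj u v : os_open u = os_open v -> u = v.
Proof.
move=> uv; have [_ uU] := os_openP u; have [_ vU] := os_openP v.
rewrite -uv in vU.
have : os_class u = os_class v.
  apply/funext => V; apply/propext.
  by rewrite (os_class_iso V uU) (os_class_iso V vU).
case: u v {uv uU vU} => c cP [d dP] /= cd; subst d.
by congr OpenSubscheme; exact: Prop_irrelevance.
Qed.

End open_subschemes.

(** * The locale of open subschemes *)

Section locale_of_opens.
Variable R : comPzRingType.
Implicit Types (u v : open_subscheme R) (A : open_subscheme R -> Prop).

Lemma open_union A : open [set p | exists a, A a /\ os_open a p].
Proof.
apply/open_basicP => p [a [Aa ap]]; have [/open_basicP oa _] := os_openP a.
by have [g pg ga] := oa _ ap; exists g => // q /ga; exists a.
Qed.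

Lemma open_finite_inter (s : seq (open_subscheme R)) :
  open [set p | forall a, List.In a s -> os_open a p].
Proof.
elim: s => [|a s IH].
  by apply/open_basicP => p _; exists 1; [exact: notin_prime1|move=> q _ a []].
have -> : [set p | forall b, List.In b (a :: s) -> os_open b p] =
    os_open a `&` [set p | forall b, List.In b s -> os_open b p]; last first.
  by apply: openI => //; have [] := os_openP a.
apply/seteqP; split=> [p ps|p [ap ps] b [<-//|]]; last exact: ps.
by split=> [|b sb]; apply: ps; [left|right].
Qed.

Lemma os_joinP A j : is_join (@os_le R) A j <->
  os_open j = [set p | exists a, A a /\ os_open a p].
Proof.
split=> [[ub least]|jE].
  apply/seteqP; split=> [|p [a [/ub/os_le_open]]]; last exact.
  rewrite -(open_subscheme_ofK (open_union A)); apply/os_le_open/least => a Aa.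
  by apply/os_le_open; rewrite open_subscheme_ofK => p ap; exists a.
split=> [a Aa|b ub]; apply/os_le_open; rewrite jE; first by move=> p ap; exists a.
by move=> p [a [/ub/os_le_open]]; exact.
Qed.

Lemma os_finite_meetP s m : is_finite_meet (@os_le R) s m <->
  os_open m = [set p | forall a, List.In a s -> os_open a p].
Proof.
split=> [[lb greatest]|mE].
  apply/seteqP; split=> [p mp a /lb/os_le_open|]; first exact.
  rewrite -(open_subscheme_ofK (open_finite_inter s)).
  apply/os_le_open/greatest => a sa.
  by apply/os_le_open; rewrite open_subscheme_ofK => p; exact.
split=> [a sa|b lb]; apply/os_le_open; rewrite mE; first by move=> p; exact.
by move=> p bp a /lb/os_le_open; exact.
Qed.

Lemma os_is_locale : is_locale (@os_le R).
Proof.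
split.
- by move=> u; apply/os_le_open.
- move=> v u w /os_le_open uv /os_le_open vw; apply/os_le_open.
  exact: subset_trans uv vw.
- move=> u v /os_le_open uv /os_le_open vu; apply: os_open_inj.
  exact/seteqP.
- move=> A; exists (open_subscheme_of (open_union A)); apply/os_joinP.
  exact: open_subscheme_ofK.
- move=> A; pose L b := forall a, A a -> os_le b a.
  exists (open_subscheme_of (open_union L)); split=> [a Aa|b bL]; apply/os_le_open.
    by rewrite open_subscheme_ofK => p [b [/(_ a Aa)/os_le_open]]; exact.
  by rewrite open_subscheme_ofK => p bp; exists b.
move=> x A j m /os_joinP jE /os_finite_meetP mE; apply/os_joinP; rewrite mE.
apply/seteqP; split=> p /=.
  move=> mp; have xp : os_open x p by apply: mp; left.
  have : os_open j p by apply: mp; right; left.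
  rewrite jE => -[a [Aa ap]].
  exists (open_subscheme_of (open_finite_inter [:: x; a])).
  rewrite open_subscheme_ofK; split; last by move=> b [<-|[<-|[]]].
  by exists a => //; apply/os_finite_meetP; exact: open_subscheme_ofK.
move=> [n [[a Aa /os_finite_meetP nE]]]; rewrite nE => np b [<-|[<-|[]]].
  by apply: np; left.
by rewrite jE; exists a; split=> //; apply: np; right; left.
Qed.

Definition os_locale : locale := Locale os_is_locale.

Lemma os_bottomP u : is_bottom (@os_le R) u <-> os_open u = set0.
Proof.
split=> [ub|uE v]; last by apply/os_le_open; rewrite uE.
apply/seteqP; split=> // p up.
have /os_le_open := ub (open_subscheme_of (@open0 (spec R))).
by rewrite open_subscheme_ofK => /(_ p up).
Qed.

Lemma os_topP u : is_top (@os_le R) u <-> os_open u = setT.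
Proof.
split=> [ut|uE v]; last by apply/os_le_open; rewrite uE.
apply/seteqP; split=> // p _.
have /os_le_open := ut (open_subscheme_of (@openT (spec R))).
by rewrite open_subscheme_ofK => /(_ p); exact.
Qed.

End locale_of_opens.

(** * Points of the Stone dual *)

Lemma in_map_list (T U : Type) (f : T -> U) (s : seq T) y :
  List.In y (map f s) <-> exists2 a, List.In a s & y = f a.
Proof.
elim: s => [|b s IH] /=; first by split=> // -[].
split=> [[<-|/IH[a sa ->]]|[a [->|sa] yE]].
- by exists b => //; left.
- by exists a => //; right.
- by left.
- by right; apply/IH; exists a.
Qed.

Lemma locale_hom_ext (L L' : locale) (f g : locale_hom L L') :
  (forall u, f u = g u) -> f = g.
Proof.
case: f g => [f f0 f1 fJ fM] [g g0 g1 gJ gM] /= fgE.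
have fg : f = g by exact: functional_extensionality_dep.
by subst g; congr LocaleHom; exact: Prop_irrelevance.
Qed.

Section stone_points.
Variable R : comPzRingType.
Let L := os_locale R.

Section point.
Variable x : spec R.

Definition point_fun (u : L) : bool := `[< os_open u x >].

Lemma point_bottom (b : L) : is_bottom (@loc_le L) b ->
  is_bottom (@loc_le one_loc) (point_fun b).
Proof.
move=> /os_bottomP bE v; apply/implyP => /asboolP.
by rewrite bE.
Qed.

Lemma point_top (t : L) : is_top (@loc_le L) t ->
  is_top (@loc_le one_loc) (point_fun t).
Proof.
by move=> /os_topP tE v; apply/implyP => _; apply/asboolP; rewrite tE.
Qed.

Lemma point_join A j : is_join (@loc_le L) A j ->
  is_join (@loc_le one_loc) (fun y => exists2 a, A a & y = point_fun a)
    (point_fun j).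
Proof.
move=> /os_joinP jE; split=> [_ [a Aa ->]|b ub]; apply/implyP => /asboolP.
  by move=> ax; apply/asboolP; rewrite jE; exists a.
rewrite jE => -[a [Aa /asboolP ax]].
by apply: (implyP (ub (point_fun a) _)) => //; exists a.
Qed.

Lemma point_meet s m : is_finite_meet (@loc_le L) s m ->
  is_finite_meet (@loc_le one_loc) (map point_fun s) (point_fun m).
Proof.
move=> /os_finite_meetP mE; split=> [_ /in_map_list[a sa ->]|b lb].
  by apply/implyP => /asboolP; rewrite mE => ms; apply/asboolP/ms.
apply/implyP => bT; apply/asboolP; rewrite mE => a sa; apply/asboolP.
by apply: (implyP (lb (point_fun a) _)) => //; apply/in_map_list; exists a.
Qed.

Definition stone_point : stone_dual L :=
  @LocaleHom one_loc L point_fun point_bottom point_top point_join point_meet.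

Lemma stone_pointP u : stone_point u = true <-> os_open u x.
Proof. by split=> [/asboolP|ux] //; exact/asboolP. Qed.

End point.

Section point_of.
Variable f : stone_dual L.

Lemma stone_mono (u v : L) : os_open u `<=` os_open v -> f u = true -> f v = true.
Proof.
move=> uv fu.
have /(pull_join f)[ub _] : is_join (@loc_le L) (fun w => w = u \/ w = v) v.
  apply/os_joinP/seteqP; split=> [p vp|p [w [[->|->]]]] //; last exact: uv.
  by exists v; split=> //; right.
by apply: (implyP (ub (f u) _)) => //; exists u => //; left.
Qed.

Lemma stone_join A (j : L) : is_join (@loc_le L) A j -> f j = true ->
  exists2 a, A a & f a = true.
Proof.
move=> /(pull_join f)[_ least] fj; apply: contrapT => noA.
have : (f j) ==> false.
  apply: least => _ [a Aa ->]; apply/implyP => fa.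
  by case: noA; exists a.
by rewrite fj.
Qed.

Definition basic_os (a : R) : L := open_subscheme_of (@basic_open_open R a).

Lemma basic_osE a : os_open (basic_os a) = basic_open a.
Proof. exact: open_subscheme_ofK. Qed.

(** D(0) is empty and D(1) is everything, D(a + b) lies in the union of D(a) and
    D(b), and D(a * b) is the intersection of D(a) and D(b). *)
Lemma stone_prime : is_prime [set a | f (basic_os a) = false].
Proof.
split=> /=.
- apply/negbTE/negP => f0.
  have b0 : is_bottom (@loc_le L) (basic_os 0).
    apply/os_bottomP; rewrite basic_osE; apply/seteqP; split=> // p.
    by case; exact: is_prime0 (specP p).
  by have := pull_bottom f b0 false; rewrite /loc_le /= f0.
- move=> a b fa fb; apply/negbTE/negP => fab.
  pose A := fun w : L => w = basic_os a \/ w = basic_os b.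
  have jA : is_join (@loc_le L) A (open_subscheme_of (open_union A)).
    by apply/os_joinP; exact: open_subscheme_ofK.
  have [|w [->|->]] := stone_join jA; rewrite ?fa ?fb //.
  apply: stone_mono fab; rewrite basic_osE open_subscheme_ofK => p pab.
  have [pa|pa] := pselect (p a); last first.
    by exists (basic_os a); rewrite basic_osE; split=> //; left.
  exists (basic_os b); rewrite basic_osE; split; first by right.
  by move=> pb; apply: pab; exact: is_primeD (specP p) _ _ pa pb.
- move=> a b fb; apply/negbTE/negP => fab; suff : f (basic_os b) = true by rewrite fb.
  apply: stone_mono fab; rewrite !basic_osE => p; exact: notin_prime_right.
- have t1 : is_top (@loc_le L) (basic_os 1).
    apply/os_topP; rewrite basic_osE; apply/seteqP; split=> // p _.
    exact: notin_prime1.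
  by have := pull_top f t1 true; rewrite /loc_le /= => ->.
have nfalse (c : bool) : ~ c = false -> c = true by case: c.
move=> a b fab; apply: contrapT => /not_orP[/nfalse fa /nfalse fb].
have /(pull_meet f)[_ greatest] :
    is_finite_meet (@loc_le L) [:: basic_os a; basic_os b] (basic_os (a * b)).
  apply/os_finite_meetP; rewrite basic_osE basic_openM; apply/seteqP; split=> p /=.
    by move=> [pa pb] w [<-|[<-|[]]]; rewrite basic_osE.
  by move=> pab; split; rewrite -basic_osE; apply: pab; [left|right; left].
have : true ==> f (basic_os (a * b)).
  by apply: greatest => _ /= [<-|[<-|[]]]; rewrite /loc_le /= ?fa ?fb.
by rewrite fab.
Qed.

Definition point_of_stone : spec R := Spec stone_prime.

(** The open set of u is the join of the D(a) that it contains, and D(a) contains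
    the point exactly if f(D(a)) is true. *)
Lemma point_of_stoneP u : f u = true <-> os_open u point_of_stone.
Proof.
have [/open_basicP ou _] := os_openP u; split=> [fu|/ou[a fa au]]; last first.
  apply: (@stone_mono (basic_os a)); first by rewrite basic_osE.
  by apply/negPn/negP => /negbTE.
have [|w [a [-> au]] fa] :=
  @stone_join (fun w => exists a, w = basic_os a /\ basic_open a `<=` os_open u) u _ fu.
  apply/os_joinP/seteqP; split=> [p /ou[a pa au]|p [w [[a [-> au]]]]].
    by exists (basic_os a); rewrite basic_osE; split=> //; exists a.
  by rewrite basic_osE => /au.
by apply: au; rewrite /basic_open /= fa.
Qed.

End point_of.

Lemma stone_pointK : cancel stone_point point_of_stone.
Proof.
move=> x; apply: spec_ext => a /=; split=> [/negbT ax|xa].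
  apply: contrapT => xa; move/negP: ax; apply.
  by apply/stone_pointP; rewrite basic_osE.
by apply/negbTE/negP => /stone_pointP; rewrite basic_osE; exact.
Qed.

Lemma point_of_stoneK : cancel point_of_stone stone_point.
Proof.
move=> f; apply: locale_hom_ext => u; apply/idP/idP.
  by move/stone_pointP/point_of_stoneP.
by move/point_of_stoneP => fu; apply/stone_pointP.
Qed.

Lemma stone_point_homeomorphism : stone_homeomorphism stone_point.
Proof.
split; first exact: Bijective stone_pointK point_of_stoneK.
move=> W; split=> [[u uW]|oW].
  rewrite (_ : [set _ | _] = os_open u); first by have [] := os_openP u.
  by apply/seteqP; split=> x /=; rewrite uW => /stone_pointP.
exists (open_subscheme_of oW) => f; rewrite -{1}(point_of_stoneK f).
by rewrite point_of_stoneP open_subscheme_ofK.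
Qed.

End stone_points.

Lemma subset_closure_compl (T : topologicalType) (U : set T) x : open U ->
  U `<=` ~` closure [set x] <-> ~ U x.
Proof.
move=> oU; split=> [Ux xU|nUx p Up clp]; first exact: Ux xU (subset_closure _).
by have [y [/= -> /nUx]] := clp _ (open_nbhs_nbhs (conj oU Up)).
Qed.

Theorem mainTheorem4 (R : comPzRingType) :
  exists (Lambda_loc : is_locale (@os_le R))
         (h : spec R -> stone_dual (Locale Lambda_loc)),
    [/\ stone_homeomorphism h,
        forall x : spec R, exists u_x : open_subscheme R,
          [/\ os_class u_x (open_over (~` closure [set x])),
              prime_ideal (@os_le R) (principal_ideal (@os_le R) u_x) &
              forall u : open_subscheme R,
                h x u = false <-> principal_ideal (@os_le R) u_x u],
        forall U : set (spec R), open U ->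
          exists u : open_subscheme R, os_class u (open_over U),
        forall u : open_subscheme R,
          exists2 U : set (spec R), open U & os_class u (open_over U) &
        forall (U : set (spec R)) (u : open_subscheme R),
          open U -> os_class u (open_over U) ->
          forall x : spec R, h x u = true <-> U x].
Proof.
exists (@os_is_locale R), (@stone_point R); split.
- exact: stone_point_homeomorphism.
- move=> x; have oc : open (~` closure [set x]) by rewrite openC; exact: closed_closure.
  exists (open_subscheme_of oc).
  have idealP u : principal_ideal (@os_le R) (open_subscheme_of oc) u <-> ~ os_open u x.
    rewrite /principal_ideal os_le_open open_subscheme_ofK subset_closure_compl //.
    by have [] := os_openP u.
  split; first exact: open_subscheme_of_class.
    split.
      by exists (open_subscheme_of openT); rewrite idealP open_subscheme_ofK => /(_ I).
    move=> s m sx /os_finite_meetP mE /idealP; apply; rewrite mE => a /sx.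
    by rewrite idealP => /contrapT.
  move=> u; rewrite idealP; split=> [ux /stone_pointP|ux].
    by rewrite ux.
  by apply/negbTE/negP => /stone_pointP.
- by move=> U oU; exists (open_subscheme_of oU); exact: open_subscheme_of_class.
- by move=> u; exists (os_open u); have [] := os_openP u.
by move=> U u oU uU x; rewrite stone_pointP (os_open_eq oU uU).
Qed.
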